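(* Let $\xi$ be an irrational non-quadratic real number such that $\beta_0(\xi)<2$. Then there exists $\varepsilon_1>0$, depending only on $\beta_0(\xi)$, such that $\beta_\varepsilon(\xi)=\beta_0(\xi)$ for every $\varepsilon$ with $0<\varepsilon<\varepsilon_1$.
   Context: A real number $\xi$ is non-quadratic if $[\mathbb{Q}(\xi):\mathbb{Q}]\ge 3$. For $\underline{x}=(x_0,x_1,x_2)\in\mathbb{Z}^3$ put $L(\underline{x})=\max(|x_0\xi-x_1|,|x_0\xi^2-x_2|)$. For $0<\varepsilon\le 1$, $\beta_\varepsilon(\xi)$ is the infimum of the set of all $\beta$ such that for every sufficiently large $B>0$ there exists $\underline{x}\in\mathbb{Z}^3$ with $1\le|x_0|\le B$ and $L(\underline{x})\le\min(B^{-1/\beta},|x_0|^{\varepsilon-1})$ (and $+\infty$ if this set is empty); $\beta_0(\xi)=\sup_{0<\varepsilon<1}\beta_\varepsilon(\xi)$. *)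

(* Defs.v *)
From mathcomp Require Import all_boot all_order all_algebra.
From mathcomp Require Import all_classical all_reals all_analysis.

Set Implicit Arguments.
Unset Strict Implicit.
Unset Printing Implicit Defensive.

Import Order.TTheory GRing.Theory Num.Theory.
Import numFieldNormedType.Exports.

Local Open Scope classical_set_scope.
Local Open Scope ring_scope.

(* Q(xi): the smallest subfield of R containing xi. *)
Definition Q_adjoin (R : realType) (xi : R) : set R :=
  [set y | forall K : {pred R}, GRing.divring_closed K -> xi \in K -> y \in K].

(* [Q(xi) : Q] >= n; the degree may be infinite. *)
Definition degree_ge (R : realType) (n : nat) (xi : R) : Prop :=
  exists v : 'I_n -> R,
    (forall i, Q_adjoin xi (v i)) /\
    (forall c : 'I_n -> rat,
        \sum_(i < n) ratr (c i) * v i = 0 -> forall i, c i = 0).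

Definition non_quadratic (R : realType) (xi : R) : Prop := degree_ge 3 xi.

Definition Lxi (R : realType) (xi : R) (x0 x1 x2 : int) : R :=
  Num.max `|x0%:~R * xi - x1%:~R| `|x0%:~R * xi ^+ 2 - x2%:~R|.

(* Only b > 0 is meaningful: any b < 0 would satisfy the condition trivially
   (take x0 = 1), and 1 / b needs b != 0. *)
Definition beta_set (R : realType) (eps xi : R) : set R :=
  [set b : R | 0 < b /\
    \forall B \near +oo, exists x0 x1 x2 : int,
      [/\ 1 <= `|x0|, `|x0|%:~R <= B &
        Lxi xi x0 x1 x2 <=
          Num.min (B `^ (- (1 / b))) (`|x0|%:~R `^ (eps - 1))]].

(* ereal_inf set0 = +oo *)
Definition beta_eps (R : realType) (eps xi : R) : \bar R :=
  ereal_inf (EFin @` beta_set eps xi).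

Definition beta0 (R : realType) (xi : R) : \bar R :=
  ereal_sup [set beta_eps eps xi | eps in [set eps : R | 0 < eps < 1]].

(* Main.v *)
(* Measure a point x of Z^3 by lsize x = ln x0 and lprec x = - ln L(x), and call
   it eta-admissible when (1 - eta) lsize x <= lprec x. Since beta_0 < 2, for
   every eta > 0 there are eta-admissible points p below any large size T with
   lprec p >= w T, where w = 1/2 + e > 1/2. Three facts follow. Large admissible
   points have nonzero determinant x0 x2 - x1^2, hence lprec x <= lsize x + O(1):
   otherwise x is a multiple of some (m^2, m n, n^2), and m z1 - n z0 and
   m z2 - n z1 are, for an admissible z just below that triple, integers too
   small to be nonzero. Three points y, x, z of increasing size and precision with
   lprec y >= w lsize z are coplanar. A rational plane through an admissible
   point y has height at least exp (e / 2 * lsize y).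

   Let x be eps-admissible with no eps'-admissible point both smaller and at
   least as precise. Take an eta-admissible y just before x and a
   6 eta-admissible z just after it, and put d = lsize z - lprec y. The point x
   makes the height of the common plane at most about exp (d / 2), so this plane
   contains all eta-admissible points of precision slightly above d / 2, in
   particular two such points a, b around precision d with
   lprec a >= w lsize b, so that lsize b - lprec a is smaller than d.
   Viewing points as symmetric matrices, y adj(a) b lies in the plane, is
   6 eta-admissible, smaller than z, and more precise than y by a fixed
   proportion of lsize x. Iterating a bounded number of times contradicts
   lprec <= lsize + O(1). Hence every large eps-admissible point may be replaced
   by an eps'-admissible one. *)
Require Import Defs.
From mathcomp Require Import all_boot all_order all_algebra.
From mathcomp Require Import all_classical all_reals all_analysis.
From mathcomp Require Import ring lra zify.

Set Implicit Arguments.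
Unset Strict Implicit.
Unset Printing Implicit Defensive.

Import Order.TTheory GRing.Theory Num.Theory.

Local Open Scope ring_scope.

Lemma normrM_le (R : numDomainType) (x y a b : R) :
  `|x| <= a -> `|y| <= b -> `|x * y| <= a * b.
Proof. by move=> xa yb; rewrite normrM ler_pM. Qed.

Lemma normrD_le (R : numDomainType) (x y a b : R) :
  `|x| <= a -> `|y| <= b -> `|x + y| <= a + b.
Proof. by move=> xa yb; apply: le_trans (ler_normD _ _) (lerD xa yb). Qed.

Lemma normrB_le (R : numDomainType) (x y a b : R) :
  `|x| <= a -> `|y| <= b -> `|x - y| <= a + b.
Proof. by move=> xa yb; apply: le_trans (ler_normB _ _) (lerD xa yb). Qed.

Lemma normr_int_ge1 (R : numDomainType) (n : int) : n != 0 -> 1 <= `|n%:~R : R|.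
Proof. by move=> n_neq0; rewrite -intr_norm (ler_int R 1) -gtz0_ge1 normr_gt0. Qed.

Lemma expRD_ge1 (R : realType) (a b : R) : 1 <= expR a + expR b -> -1 <= a \/ -1 <= b.
Proof.
move=> sum_ge1; case: (lerP (-1) a) => a_lt; first by left.
right; rewrite leNgt; apply/negP => b_lt.
have inv_half : expR (-1) <= 2^-1 :> R.
  by rewrite expRN lef_pV2 ?posrE ?expR_gt0 //; exact: (expR_ge1Dx 1).
rewrite -ltr_expR in a_lt; rewrite -ltr_expR in b_lt; lra.
Qed.

(** * Integer points as symmetric matrices *)

Record point := Point { coord0 : int; coord1 : int; coord2 : int }.

Definition positive (p : point) : bool := 0 < coord0 p.

Definition point_neq0 (p : point) : bool :=
  [|| coord0 p != 0, coord1 p != 0 | coord2 p != 0].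

Definition scale_point (c : int) (p : point) : point :=
  Point (c * coord0 p) (c * coord1 p) (c * coord2 p).

Definition dot (h p : point) : int :=
  coord0 h * coord0 p + coord1 h * coord1 p + coord2 h * coord2 p.

Definition cross (u v : point) : point :=
  Point (coord1 u * coord2 v - coord2 u * coord1 v)
        (coord2 u * coord0 v - coord0 u * coord2 v)
        (coord0 u * coord1 v - coord1 u * coord0 v).

Definition det3 (u v w : point) : int := dot (cross u v) w.

(* A point u stands for the symmetric matrix [[u0, u1], [u1, u2]]. *)
Definition symdet (u : point) : int := coord0 u * coord2 u - coord1 u * coord1 u.

Definition symdet_polar (u v : point) : int :=
  coord0 u * coord2 v + coord2 u * coord0 v - 2 * (coord1 u * coord1 v).

(* Twice the symmetric part of y adj(a) b; y adj(a) b is itself symmetric when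
   y, a, b are coplanar. *)
Definition bracket (y a b : point) : point :=
  let comb u0 a0 b0 :=
    symdet_polar y a * b0 + symdet_polar b a * u0 - symdet_polar y b * a0 in
  Point (comb (coord0 y) (coord0 a) (coord0 b))
        (comb (coord1 y) (coord1 a) (coord1 b))
        (comb (coord2 y) (coord2 a) (coord2 b)).

Lemma dot_crossl (u v : point) : dot (cross u v) u = 0.
Proof. by rewrite /dot /=; ring. Qed.

Lemma dot_crossr (u v : point) : dot (cross u v) v = 0.
Proof. by rewrite /dot /=; ring. Qed.

Lemma det3_rot (u v w : point) : det3 u v w = det3 v w u.
Proof. by rewrite /det3 /dot /=; ring. Qed.

Lemma det3_eq0_normal (h u v w : point) : point_neq0 h ->
  dot h u = 0 -> dot h v = 0 -> dot h w = 0 -> det3 u v w = 0.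
Proof.
move=> h_neq0 hu hv hw.
have cramer0 : coord0 h * det3 u v w = dot h u * coord0 (cross v w) +
    dot h v * coord0 (cross w u) + dot h w * coord0 (cross u v).
  by rewrite /det3 /dot /=; ring.
have cramer1 : coord1 h * det3 u v w = dot h u * coord1 (cross v w) +
    dot h v * coord1 (cross w u) + dot h w * coord1 (cross u v).
  by rewrite /det3 /dot /=; ring.
have cramer2 : coord2 h * det3 u v w = dot h u * coord2 (cross v w) +
    dot h v * coord2 (cross w u) + dot h w * coord2 (cross u v).
  by rewrite /det3 /dot /=; ring.
apply/eqP; move/eqP: cramer0; move/eqP: cramer1; move/eqP: cramer2.
rewrite hu hv hw !mul0r !addr0 !mulf_eq0.
by case/or3P: h_neq0 => /negPf ->.
Qed.

Lemma dot_bracket (h y a b : point) :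
  dot h y = 0 -> dot h a = 0 -> dot h b = 0 -> dot h (bracket y a b) = 0.
Proof.
move=> hy ha hb.
have -> : dot h (bracket y a b) = symdet_polar y a * dot h b +
    symdet_polar b a * dot h y - symdet_polar y b * dot h a.
  by rewrite /dot /=; ring.
by rewrite hy ha hb !mulr0 addr0 subrr.
Qed.

Definition veronese (m n : int) : point := Point (m * m) (m * n) (n * n).

Lemma symdet_eq0_veronese (p : point) : positive p -> symdet p = 0 ->
  exists c m n, [/\ 0 < c, 0 < m, coprimez m n & p = scale_point c (veronese m n)].
Proof.
case: p => p0 p1 p2; rewrite /positive /symdet /= => p0_gt0 /subr0_eq det0.
pose g := gcdz p0 p1.
have g_gt0 : 0 < g by rewrite /g /gcdz ltz_nat gcdn_gt0; lia.
have [m p0E] : exists m, p0 = m * g by apply/dvdzP; exact: dvdz_gcdl.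
have [n p1E] : exists n, p1 = n * g by apply/dvdzP; exact: dvdz_gcdr.
have mn_coprime : coprimez m n.
  have : gcdz (m * g) (n * g) = g by rewrite -p0E -p1E.
  by rewrite -mulz_gcdl; nia.
have mp2 : m * p2 = g * (n * n) by nia.
have : (m %| g)%Z.
  rewrite -(Gauss_dvdzl _ (_ : coprimez m (n * n))) ?coprimezMr ?mn_coprime //.
  by rewrite -mp2 dvdz_mulr.
case/dvdzP => c gE; exists c, m, n; rewrite /scale_point /veronese /=.
split; [nia | nia | exact: mn_coprime |].
by congr Point; nia.
Qed.

Lemma veronese_minor_neq0 (m n : int) (z : point) :
  0 < m -> coprimez m n -> positive z -> coord0 z < m * m ->
  (m * coord1 z - n * coord0 z != 0) || (m * coord2 z - n * coord1 z != 0).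
Proof.
rewrite /positive => m_gt0 mn_coprime z_pos; apply: contraLR.
rewrite negb_or !negbK !subr_eq0 -leNgt => /andP[/eqP minor1 /eqP minor2].
have /dvdzP[k z0E] : (m %| coord0 z)%Z.
  by rewrite -(Gauss_dvdzr _ mn_coprime) -minor1 dvdz_mulr.
have z1E : coord1 z = n * k by nia.
have /dvdzP[l kE] : (m %| k)%Z.
  rewrite -(Gauss_dvdzr _ mn_coprime) -(Gauss_dvdzr _ mn_coprime).
  by rewrite -z1E -minor2 dvdz_mulr.
have mm_gt0 : 0 < m * m by rewrite mulr_gt0.
rewrite z0E kE -mulrA ler_peMl ?(ltW mm_gt0) // -gtz0_ge1 -(pmulr_lgt0 _ mm_gt0).
by rewrite mulrA -kE -z0E.
Qed.

(** * Irrational numbers that are not quadratic *)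

Definition linear_form (R : realType) (xi : R) (h : point) : R :=
  (coord0 h)%:~R + (coord1 h)%:~R * xi + (coord2 h)%:~R * xi ^+ 2.

Section RationalSpan.
Variables (R : realType) (xi : R).

Definition rat_span : {pred R} :=
  [pred y | `[< exists u v : rat, y = ratr u + ratr v * xi >]].

Hypothesis xi_irr : irrational xi.

Lemma irrational_free (u v : rat) : ratr u + ratr v * xi = 0 -> u = 0 /\ v = 0.
Proof.
have [-> | v_neq0] := eqVneq v 0.
  by rewrite rmorph0 mul0r addr0 => /eqP; rewrite fmorph_eq0 => /eqP.
move=> uv0; exfalso; apply: xi_irr; exists (- u / v) => //.
have vR_neq0 : ratr v != 0 :> R by rewrite fmorph_eq0.
apply: (mulfI vR_neq0); rewrite fmorph_div rmorphN mulrCA divff // mulr1.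
by apply/esym/eqP; rewrite -addr_eq0 addrC uv0.
Qed.

Hypothesis sqr_span : xi ^+ 2 \in rat_span.

Lemma rat_span_mul : {in rat_span &, forall x y, x * y \in rat_span}.
Proof.
have /asboolP[s [t xi2E]] := sqr_span.
move=> x y /asboolP[u [v ->]] /asboolP[u' [v' ->]]; apply/asboolP.
exists (u * u' + v * v' * s), (u * v' + v * u' + v * v' * t).
transitivity (ratr u * ratr u' + (ratr u * ratr v' + ratr v * ratr u') * xi
    + ratr v * ratr v' * xi ^+ 2); first by ring.
by rewrite xi2E !(rmorphD, rmorphM) /=; ring.
Qed.

Lemma rat_span_inv : {in rat_span, forall x, x^-1 \in rat_span}.
Proof.
have /asboolP[s [t xi2E]] := sqr_span.
move=> x /asboolP[u [v ->]]; apply/asboolP.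
have [x0|x_neq0] := eqVneq (ratr u + ratr v * xi) 0.
  by exists 0, 0; rewrite x0 invr0 rmorph0 mul0r addr0.
pose n : rat := u * u + u * v * t - v * v * s.
have normE : (ratr u + ratr v * xi) * (ratr (u + v * t) + ratr (- v) * xi) = ratr n.
  rewrite /n !(rmorphD, rmorphB, rmorphM, rmorphN) /=.
  transitivity (ratr u * ratr u + ratr u * ratr v * ratr t
    + ratr v * ratr v * ratr t * xi - ratr v * ratr v * xi ^+ 2); first by ring.
  by rewrite xi2E; ring.
have n_neq0 : ratr n != 0 :> R.
  rewrite -normE mulf_neq0 //; apply/negP => /eqP /irrational_free [u0 /eqP].
  rewrite oppr_eq0 => /eqP v0; move: x_neq0 u0; rewrite v0 mul0r addr0 => + u0.
  by rewrite u0 !rmorph0 mul0r addr0 eqxx.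
exists ((u + v * t) / n), (- v / n); apply: (mulfI x_neq0).
have ratr_divn a : ratr (a / n) = ratr a / ratr n :> R by rewrite fmorph_div.
by rewrite divff // !ratr_divn [_ / _ * xi]mulrAC -mulrDl mulrA normE divff.
Qed.

Lemma rat_span_divring_closed : GRing.divring_closed rat_span.
Proof.
split.
- by apply/asboolP; exists 1, 0; rewrite rmorph1 rmorph0 mul0r addr0.
- move=> x y /asboolP[u [v ->]] /asboolP[u' [v' ->]]; apply/asboolP.
  by exists (u - u'), (v - v'); rewrite !rmorphB /=; ring.
- by move=> x y x_span y_span; rewrite rat_span_mul ?rat_span_inv.
Qed.

Lemma rat_span_dependent (n : nat) (v : 'I_n -> R) : (2 < n)%N ->
  (forall i, v i \in rat_span) ->
  exists2 c : 'I_n -> rat, \sum_(i < n) ratr (c i) * v i = 0 & exists i, c i != 0.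
Proof.
move=> n_gt2 v_span.
have /choice[f vE] : forall i, exists uv : rat * rat, v i = ratr uv.1 + ratr uv.2 * xi.
  by move=> i; have /asboolP[u [w ->]] := v_span i; exists (u, w).
pose A : 'M[rat]_(n, 2) := \matrix_(i, j) if j == 0 then (f i).1 else (f i).2.
have : kermx A != 0.
  by rewrite -mxrank_eq0 mxrank_ker -lt0n subn_gt0 (leq_ltn_trans (rank_leq_col A)).
case/rowV0Pn => c /sub_kermxP cA0 /rV0Pn[i ci_neq0].
exists (c 0); last by exists i.
have coordE j : \sum_(k < n) c 0 k * A k j = 0.
  by have := congr1 (fun M : 'rV_2 => M 0 j) cA0; rewrite !mxE.
have coord_sum (g : 'I_n -> rat) j : (forall k, A k j = g k) ->
    \sum_(k < n) ratr (c 0 k) * ratr (g k) = 0 :> R.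
  move=> gE; transitivity (ratr (\sum_k c 0 k * A k j) : R).
    by rewrite rmorph_sum; apply: eq_bigr => k _; rewrite /= gE rmorphM.
  by rewrite coordE rmorph0.
have sum1 := coord_sum (fun k => (f k).1) 0 (fun k => mxE _ _ _ _).
have sum2 := coord_sum (fun k => (f k).2) 1 (fun k => mxE _ _ _ _).
under eq_bigr do rewrite vE mulrDr mulrA.
by rewrite big_split /= sum1 -mulr_suml sum2 mul0r addr0.
Qed.

End RationalSpan.

Lemma non_quadratic_sqr (R : realType) (xi : R) :
  irrational xi -> non_quadratic xi -> xi ^+ 2 \notin rat_span xi.
Proof.
move=> xi_irr [v [v_adj v_free]]; apply/negP => sqr_span.
have xi_span : xi \in rat_span xi.
  by apply/asboolP; exists 0, 1; rewrite rmorph0 rmorph1 add0r mul1r.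
have v_span i : v i \in rat_span xi.
  exact: v_adj (rat_span_divring_closed xi_irr sqr_span) xi_span.
have [//|c rel [i]] := rat_span_dependent _ v_span.
by rewrite (v_free c rel) eqxx.
Qed.

Lemma non_quadratic_linear_form_neq0 (R : realType) (xi : R) (h : point) :
  irrational xi -> non_quadratic xi -> point_neq0 h -> linear_form xi h != 0.
Proof.
case: h => h0 h1 h2 xi_irr xi_nq h_neq0; apply/negP; rewrite /linear_form /= => /eqP form0.
have [h2_0|h2_neq0] := eqVneq h2 0.
  have [|/eqP + /eqP] := @irrational_free R xi xi_irr h0%:~R h1%:~R.
    by rewrite !ratr_int; move: form0; rewrite h2_0 mul0r addr0.
  by rewrite !intr_eq0 => h0_0 h1_0; rewrite /point_neq0 /= h0_0 h1_0 h2_0 in h_neq0.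
have h2R_neq0 : h2%:~R != 0 :> R by rewrite intr_eq0.
apply: (negP (non_quadratic_sqr xi_irr xi_nq)); apply/asboolP.
exists (- h0%:~R / h2%:~R), (- h1%:~R / h2%:~R).
rewrite !fmorph_div !rmorphN !rmorph_int; apply: (mulfI h2R_neq0).
transitivity (- h0%:~R - h1%:~R * xi : R); last by field.
by apply/eqP; rewrite -subr_eq0 -form0; apply/eqP; ring.
Qed.

(** * Size and precision of integer points *)

Section Approximation.
Variables (R : realType) (xi : R).

Definition lead (p : point) : R := (coord0 p)%:~R.
Definition dev1 (p : point) : R := (coord0 p)%:~R * xi - (coord1 p)%:~R.
Definition dev2 (p : point) : R := (coord0 p)%:~R * xi ^+ 2 - (coord2 p)%:~R.
Definition dev (p : point) : R := Lxi xi (coord0 p) (coord1 p) (coord2 p).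

(* In the coordinates (lead, dev1, quadval) the form symdet reads
   lead * quadval - dev1 ^+ 2. *)
Definition quadval (p : point) : R := 2 * xi * dev1 p - dev2 p.

Definition xi_bound : R := 2 * `|xi| + 2.

(* A normal vector h of a plane passing close to (1, xi, xi^2) has its first
   coordinate controlled by the other two. *)
Definition plane_height (h : point) : R := `|(coord1 h)%:~R| + `|(coord2 h)%:~R|.

Definition lsize (p : point) : R := ln (lead p).
Definition lprec (p : point) : R := - ln (dev p).

Lemma dev1_le (p : point) : `|dev1 p| <= dev p.
Proof. by rewrite /dev /Lxi le_max lexx. Qed.

Lemma dev2_le (p : point) : `|dev2 p| <= dev p.
Proof. by rewrite /dev /Lxi le_max lexx orbT. Qed.

Lemma dev_ge0 (p : point) : 0 <= dev p.
Proof. exact: le_trans (normr_ge0 _) (dev1_le p). Qed.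

Lemma xi_bound_ge2 : 2 <= xi_bound.
Proof. by rewrite /xi_bound; have := normr_ge0 xi; lra. Qed.

Lemma xi_bound_sqr_ge : 2 * xi_bound <= xi_bound ^+ 2.
Proof. by have := xi_bound_ge2; rewrite expr2; nra. Qed.

Lemma xi_bound_cube_ge :
  [/\ 8 <= xi_bound ^+ 3, 4 * xi_bound <= xi_bound ^+ 3
    & 2 * xi_bound ^+ 2 <= xi_bound ^+ 3].
Proof.
have := xi_bound_ge2; have := xi_bound_sqr_ge => ? ?.
have : 2 * xi_bound ^+ 2 <= xi_bound ^+ 3.
  by rewrite (exprS _ 2) ler_wpM2r ?sqr_ge0 ?xi_bound_ge2.
by split; lra.
Qed.

Lemma norm_2xi : `|2 * xi| = xi_bound - 2.
Proof. by rewrite normrM (ger0_norm (_ : 0 <= 2)) // addrK. Qed.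

Lemma quadval_le (p : point) : `|quadval p| <= xi_bound * dev p.
Proof.
have := normrB_le (normrM_le (lexx `|2 * xi|) (dev1_le p)) (dev2_le p).
by move/le_trans; apply; rewrite norm_2xi; have := dev_ge0 p; lra.
Qed.

Lemma dev_le_dev1_quadval (p : point) (a b : R) :
  `|dev1 p| <= a -> `|quadval p| <= b -> dev p <= xi_bound * a + b.
Proof.
move=> dev1_le_a quadval_le_b.
have a_ge0 := le_trans (normr_ge0 _) dev1_le_a.
have b_ge0 := le_trans (normr_ge0 _) quadval_le_b.
rewrite /dev /Lxi ge_max; apply/andP; split.
  apply: le_trans dev1_le_a _; rewrite -[leLHS]addr0; apply: lerD => //.
  by rewrite ler_peMl //; have := xi_bound_ge2; lra.
have := normrB_le (normrM_le (lexx `|2 * xi|) dev1_le_a) quadval_le_b.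
by rewrite subKr norm_2xi => /le_trans; apply; lra.
Qed.

Lemma symdetE (p : point) : (symdet p)%:~R = lead p * quadval p - dev1 p ^+ 2.
Proof. by rewrite /symdet /lead /quadval /dev1 /dev2; ring. Qed.

Lemma dotE (h p : point) : (dot h p)%:~R =
  lead p * linear_form xi h
  - ((coord1 h)%:~R * dev1 p + (coord2 h)%:~R * dev2 p).
Proof. by rewrite /dot /linear_form /lead /dev1 /dev2; ring. Qed.

Lemma dev_scale (c : int) (p : point) : dev (scale_point c p) = `|c|%:~R * dev p.
Proof.
by rewrite /dev /Lxi /= !intrM intr_norm maxr_pMr // -!normrM !mulrBr !mulrA.
Qed.

Lemma coord1_cross (x y : point) :
  (coord1 (cross x y))%:~R = lead x * dev2 y - lead y * dev2 x.
Proof. by rewrite /lead /dev2 /=; ring. Qed.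

Lemma coord2_cross (x y : point) :
  (coord2 (cross x y))%:~R = lead y * dev1 x - lead x * dev1 y.
Proof. by rewrite /lead /dev1 /=; ring. Qed.

Lemma det3E (x y z : point) : (det3 x y z)%:~R =
  lead x * (dev1 y * dev2 z - dev2 y * dev1 z)
  - lead y * (dev1 x * dev2 z - dev2 x * dev1 z)
  + lead z * (dev1 x * dev2 y - dev2 x * dev1 y).
Proof. by rewrite /det3 /dot /lead /dev1 /dev2 /=; ring. Qed.

Lemma det3_eq0_dev1E (p y z : point) : det3 p y z = 0 ->
  dev1 p * (lead z * quadval y - lead y * quadval z) =
  lead p * (dev1 z * quadval y - dev1 y * quadval z)
  - quadval p * (lead y * dev1 z - lead z * dev1 y).
Proof.
move=> coplanar; apply/eqP; rewrite -subr_eq0.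
have : (- det3 p y z)%:~R = 0 :> R by rewrite coplanar oppr0.
by move=> <-; rewrite /det3 /dot /quadval /lead /dev1 /dev2 /=; apply/eqP; ring.
Qed.

Lemma lead_bracket (y a b : point) : lead (bracket y a b) =
  2 * (lead y * lead b * quadval a - dev1 a * (dev1 y * lead b + dev1 b * lead y)
       + dev1 y * dev1 b * lead a).
Proof.
by rewrite /quadval /lead /dev1 /dev2 /= /symdet_polar; ring.
Qed.

Lemma quadval_bracket (y a b : point) : quadval (bracket y a b) =
  2 * (lead a * quadval y * quadval b - dev1 y * dev1 a * quadval b
       - dev1 b * dev1 a * quadval y + dev1 y * dev1 b * quadval a).
Proof.
by rewrite /quadval /lead /dev1 /dev2 /= /symdet_polar; ring.
Qed.

Lemma lead_ge1 (p : point) : positive p -> 1 <= lead p.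
Proof. by rewrite /lead (ler_int R 1). Qed.

Lemma lead_gt0 (p : point) : positive p -> 0 < lead p.
Proof. by move=> /lead_ge1; lra. Qed.

Lemma norm_lead (p : point) : positive p -> `|lead p| = lead p.
Proof. by move=> /lead_gt0 p_gt0; rewrite gtr0_norm. Qed.

Lemma dot_dev_le (h p : point) :
  `|(coord1 h)%:~R * dev1 p + (coord2 h)%:~R * dev2 p| <= plane_height h * dev p.
Proof.
rewrite /plane_height mulrDl.
by apply: normrD_le; apply: normrM_le; rewrite ?dev1_le ?dev2_le.
Qed.

Lemma on_plane_linear_form_le (h w : point) : positive w -> dot h w = 0 ->
  lead w * `|linear_form xi h| <= plane_height h * dev w.
Proof.
move=> w_pos hw; rewrite -(norm_lead w_pos) -normrM.
suff -> : lead w * linear_form xi h = (coord1 h)%:~R * dev1 w + (coord2 h)%:~R * dev2 w.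
  exact: dot_dev_le.
by apply/eqP; rewrite -subr_eq0 -dotE hw.
Qed.

Lemma off_plane_ge1 (h p w : point) :
  positive p -> positive w -> dot h p != 0 -> dot h w = 0 ->
  1 <= plane_height h * (lead p * dev w / lead w + dev p).
Proof.
move=> p_pos w_pos hp hw; apply: le_trans (normr_int_ge1 _ hp) _.
rewrite dotE.
have form_le : `|linear_form xi h| <= plane_height h * dev w / lead w.
  by rewrite ler_pdivlMr ?lead_gt0 // mulrC on_plane_linear_form_le.
have := normrB_le (normrM_le (lexx `|lead p|) form_le) (dot_dev_le h p).
move/le_trans; apply; rewrite norm_lead // le_eqVlt; apply/orP; left.
by apply/eqP; ring.
Qed.

Lemma plane_height_cross_le (x y : point) : positive x -> positive y ->
  plane_height (cross x y) <= 2 * (lead x * dev y + lead y * dev x).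
Proof.
move=> x_pos y_pos; rewrite /plane_height coord1_cross coord2_cross.
have term_le u v d : `|d| <= dev v -> `|lead u * d| <= `|lead u| * dev v.
  exact: normrM_le.
have := normrB_le (term_le x y _ (dev2_le y)) (term_le y x _ (dev2_le x)).
have := normrB_le (term_le y x _ (dev1_le x)) (term_le x y _ (dev1_le y)).
by rewrite !norm_lead //; lra.
Qed.

Lemma det3_neq0_ge1 (x y z : point) :
  positive x -> positive y -> positive z -> det3 x y z != 0 ->
  1 <= 2 * (lead x * dev y * dev z + lead y * dev x * dev z + lead z * dev x * dev y).
Proof.
move=> x_pos y_pos z_pos nz; apply: le_trans (normr_int_ge1 _ nz) _; rewrite det3E.
have minor_le u v : `|dev1 u * dev2 v - dev2 u * dev1 v| <= dev u * dev v + dev u * dev v.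
  by apply: normrB_le; apply: normrM_le; rewrite ?dev1_le ?dev2_le.
have term_le u v w := normrM_le (lexx `|lead u|) (minor_le v w).
have := normrD_le (normrB_le (term_le x y z) (term_le y x z)) (term_le z x y).
by rewrite !norm_lead //; lra.
Qed.

Hypothesis xi_irr : irrational xi.

Lemma irrational_dist_neq0 (n m : int) : n != 0 -> n%:~R * xi - m%:~R != 0.
Proof.
move=> n_neq0; apply/negP => /eqP /subr0_eq nxi; apply: xi_irr.
exists (m%:~R / n%:~R) => //.
by rewrite fmorph_div !rmorph_int -nxi mulrC mulKf // intr_eq0.
Qed.

Lemma dev_gt0 (p : point) : positive p -> 0 < dev p.
Proof.
move=> p_pos; apply: lt_le_trans (dev1_le p).
by rewrite normr_gt0 irrational_dist_neq0 // gt_eqF.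
Qed.

Lemma lead_expR (p : point) : positive p -> lead p = expR (lsize p).
Proof. by move=> p_pos; rewrite lnK // posrE lead_gt0. Qed.

Lemma dev_expR (p : point) : positive p -> dev p = expR (- lprec p).
Proof. by move=> p_pos; rewrite opprK lnK // posrE dev_gt0. Qed.

Lemma lsize_ge0 (p : point) : positive p -> 0 <= lsize p.
Proof. by move=> p_pos; rewrite ln_ge0 // lead_ge1. Qed.

Lemma lsize_lt (x y : point) : positive x -> positive y ->
  (lsize x < lsize y) = (coord0 x < coord0 y).
Proof. by move=> x_pos y_pos; rewrite -ltr_expR -!lead_expR // ltr_int. Qed.

(* Constants depending only on xi are absorbed into an additive error K at
   the logarithmic scale. *)
Definition slack (K : R) : Prop := 1 <= K /\ 1000 * xi_bound ^+ 3 <= expR (K - 1).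

Lemma exists_slack (M : R) : exists2 K : R, slack K & M <= K.
Proof.
exists (Num.max (1 + 1000 * xi_bound ^+ 3) M); last by rewrite le_max lexx orbT.
have [cube_ge8 _ _] := xi_bound_cube_ge.
set K := Num.max _ _.
have K_ge : 1 + 1000 * xi_bound ^+ 3 <= K by rewrite le_max lexx.
by split; [lra | have := expR_ge1Dx (K - 1); lra].
Qed.

Lemma slack_ler (K c u v : R) : slack K -> c <= 1000 * xi_bound ^+ 3 ->
  expR u <= c * expR v -> u <= K - 1 + v.
Proof.
move=> [_ K_slack] c_le uv; rewrite -ler_expR expRD; apply: le_trans uv _.
by rewrite ler_wpM2r ?expR_ge0 // (le_trans c_le).
Qed.

Lemma slack_lerD (K c u v w : R) : slack K -> c <= 1000 * xi_bound ^+ 3 ->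
  expR u <= c * (expR v + expR w) -> u <= K + v \/ u <= K + w.
Proof.
move=> [_ K_slack] c_le uvw.
have /expRD_ge1 : 1 <= expR (K - 1 + v - u) + expR (K - 1 + w - u).
  rewrite !(expRD _ (- u)) -mulrDl expRN ler_pdivlMr ?expR_gt0 // mul1r.
  rewrite !(expRD (K - 1)) -mulrDr; apply: le_trans uvw _.
  by rewrite ler_wpM2r ?addr_ge0 ?expR_ge0 // (le_trans c_le).
by case=> ?; [left | right]; lra.
Qed.

Lemma plane_height_gt0 (h : point) : 0 < plane_height h -> point_neq0 h.
Proof.
rewrite /point_neq0; apply: contraLR => /norP [_ /norP [/negPn/eqP h1 /negPn/eqP h2]].
by rewrite /plane_height h1 h2 !normr0 addr0 ltxx.
Qed.

Lemma off_plane_log (K : R) (h p w : point) : slack K ->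
  positive p -> positive w -> dot h p != 0 -> dot h w = 0 ->
  lprec w + lsize w <= ln (plane_height h) + lsize p + K \/
  lprec p <= ln (plane_height h) + K.
Proof.
move=> K_slack p_pos w_pos hp hw; have := off_plane_ge1 p_pos w_pos hp hw.
have [h_gt0|h_le0] := ltrP 0 (plane_height h); last first.
  have p_ge0 : 0 <= lead p * dev w / lead w + dev p.
    by rewrite addr_ge0 ?mulr_ge0 ?invr_ge0 ?dev_ge0 // ltW ?lead_gt0.
  by rewrite leNgt (le_lt_trans _ ltr01) // mulr_le0_ge0.
rewrite !lead_expR // !dev_expR // -{1}(lnK (h_gt0 : _ \in Num.pos)).
rewrite -expRN mulrDr -!expRD.
rewrite -[1]expR0 -[X in _ <= X]mul1r => /(slack_lerD K_slack).
by case=> [|?|?]; [case: xi_bound_cube_ge; lra | left; lra | right; lra].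
Qed.

Lemma plane_height_cross_gt0 (x y : point) : positive x -> positive y ->
  lsize x < lsize y -> lprec x <= lprec y -> 0 < plane_height (cross x y).
Proof.
move=> x_pos y_pos size_lt prec_le; rewrite lt_neqAle addr_ge0 // andbT eq_sym.
rewrite /plane_height paddr_eq0 // !normr_eq0 coord1_cross coord2_cross !subr_eq0.
apply/negP => /andP[/eqP dev2_eq /eqP dev1_eq].
have dev_eq : lead x * dev y = lead y * dev x.
  rewrite /dev /Lxi -/(dev1 y) -/(dev2 y) -/(dev1 x) -/(dev2 x).
  rewrite !maxr_pMr ?(ltW (lead_gt0 _)) //.
  rewrite -{1 2}(norm_lead x_pos) -{1 2}(norm_lead y_pos) -!normrM.
  by rewrite dev1_eq dev2_eq.
have lead_lt : lead x < lead y by rewrite !lead_expR // ltr_expR.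
have dev_yx : dev y <= dev x by rewrite !dev_expR // ler_expR lerN2.
have : lead x * dev y < lead y * dev x.
  apply: (lt_le_trans (y := lead y * dev y)).
    by rewrite ltr_pM2r ?dev_gt0.
  by rewrite ler_pM2l ?lead_gt0.
by rewrite dev_eq ltxx.
Qed.

Lemma ln_plane_height_cross_le (K : R) (x y : point) : slack K ->
  positive x -> positive y -> lsize x < lsize y -> lprec x <= lprec y ->
  ln (plane_height (cross x y)) <= lsize y - lprec x + K.
Proof.
move=> K_slack x_pos y_pos size_lt prec_le.
have h_gt0 := plane_height_cross_gt0 x_pos y_pos size_lt prec_le.
have := plane_height_cross_le x_pos y_pos.
rewrite -{1}(lnK (h_gt0 : _ \in Num.pos)) !lead_expR // !dev_expR // -!expRD => h_le.
suff : ln (plane_height (cross x y)) <= K - 1 + (lsize y - lprec x) by lra.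
apply: (slack_ler (c := 4) K_slack); first by case: xi_bound_cube_ge; lra.
apply: le_trans h_le _.
have : expR (lsize x - lprec y) <= expR (lsize y - lprec x) by rewrite ler_expR; lra.
by lra.
Qed.

Lemma det3_neq0_log (K : R) (x y z : point) : slack K ->
  positive x -> positive y -> positive z ->
  lsize x <= lsize y <= lsize z -> lprec x <= lprec y <= lprec z ->
  det3 x y z != 0 -> lprec x + lprec y <= lsize z + K.
Proof.
move=> K_slack x_pos y_pos z_pos /andP[sxy syz] /andP[lxy lyz].
move/(det3_neq0_ge1 x_pos y_pos z_pos).
rewrite !lead_expR // !dev_expR // -!expRD => det_ge1.
suff : 0 <= K - 1 + (lsize z - lprec x - lprec y) by lra.
apply: (slack_ler (c := 6) K_slack); first by case: xi_bound_cube_ge; lra.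
rewrite expR0; apply: le_trans det_ge1 _.
have : expR (lsize x - lprec y - lprec z) <= expR (lsize z - lprec x - lprec y).
  by rewrite ler_expR; lra.
have : expR (lsize y - lprec x - lprec z) <= expR (lsize z - lprec x - lprec y).
  by rewrite ler_expR; lra.
by lra.
Qed.

Lemma symdet_neq0_log (K : R) (p : point) : slack K ->
  positive p -> 0 <= lprec p -> symdet p != 0 -> lprec p <= lsize p + K.
Proof.
move=> K_slack p_pos prec_ge0 nz.
suff : 0 <= K - 1 + (lsize p - lprec p) by lra.
apply: (slack_ler (c := 2 * xi_bound) K_slack); first by case: xi_bound_cube_ge; lra.
rewrite expR0 expRD -lead_expR // -dev_expR //.
have dev_le1 : dev p <= 1 by rewrite dev_expR // -[leRHS]expR0 ler_expR; lra.
apply: le_trans (normr_int_ge1 _ nz) _; rewrite symdetE expr2.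
have := normrB_le (normrM_le (lexx `|lead p|) (quadval_le p))
  (normrM_le (dev1_le p) (dev1_le p)).
move/le_trans; apply; rewrite norm_lead //.
have dev2_le_lead : dev p * dev p <= lead p * dev p.
  by rewrite ler_wpM2r ?dev_ge0 // (le_trans dev_le1) ?lead_ge1.
have : lead p * dev p <= xi_bound * (lead p * dev p).
  rewrite ler_peMl ?mulr_ge0 ?dev_ge0 // ?ltW ?lead_gt0 //.
  by have := xi_bound_ge2; lra.
by lra.
Qed.

Lemma dev_small (p : point) : positive p -> 4 <= lprec p -> dev p <= 16^-1.
Proof.
move=> p_pos prec_ge; rewrite dev_expR // expRN lef_pV2 ?posrE ?expR_gt0 //.
apply: (le_trans (y := expR 1 ^+ 4)); last by rewrite -expRM_natl ler_expR mulr1.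
have -> : 16 = (1 + 1) ^+ 4 :> R by ring.
by rewrite ler_pXn2r ?nnegrE ?expR_ge0 // expR_ge1Dx.
Qed.

Lemma lead_quadval_ge (p : point) : positive p -> dev p <= 16^-1 ->
  symdet p != 0 -> 2^-1 <= lead p * `|quadval p|.
Proof.
move=> p_pos dev_le16 /(normr_int_ge1 R); rewrite symdetE expr2 => det_ge1.
have := le_trans det_ge1 (ler_normB _ _); rewrite [`|lead p * _|]normrM norm_lead //.
have := normrM_le (le_trans (dev1_le p) dev_le16) (le_trans (dev1_le p) dev_le16).
by lra.
Qed.

Lemma lead_bracket_approx (y a b : point) :
  positive y -> positive a -> positive b ->
  dev y <= 16^-1 -> dev a <= 16^-1 -> dev b <= 16^-1 -> symdet a != 0 ->
  lead a <= lead y -> lead a <= lead b ->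
  `|lead (bracket y a b) - 2 * (lead y * lead b * quadval a)| <=
  lead y * lead b * `|quadval a|.
Proof.
move=> y_pos a_pos b_pos dy da db a_det ay ab; rewrite lead_bracket.
have [y1 a1 b1] := And3 (lead_ge1 y_pos) (lead_ge1 a_pos) (lead_ge1 b_pos).
have small p : dev p <= 16^-1 -> `|dev1 p| <= 16^-1 by apply: le_trans (dev1_le p).
have err1 : `|dev1 a * (dev1 y * lead b + dev1 b * lead y)| <=
    16^-1 * (16^-1 * lead b + 16^-1 * lead y).
  apply: (normrM_le (small _ da)); apply: normrD_le; apply: normrM_le;
    by rewrite ?small ?norm_lead.
have err2 : `|dev1 y * dev1 b * lead a| <= 16^-1 * 16^-1 * lead a.
  by apply: normrM_le; rewrite ?norm_lead ?normrM_le ?small.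
have err := normrM_le (lexx `|2 : R|) (normrB_le err2 err1).
rewrite [X in `|X|](_ : _ = 2 * (dev1 y * dev1 b * lead a -
  dev1 a * (dev1 y * lead b + dev1 b * lead y))); last by ring.
apply: le_trans err _; rewrite normr_nat -(ler_pM2l (lead_gt0 a_pos)).
have yb_gt0 : 0 < lead y * lead b by rewrite mulr_gt0 ?lead_gt0.
have main : lead y * lead b * 2^-1 <= lead y * lead b * (lead a * `|quadval a|).
  by rewrite ler_pM2l // lead_quadval_ge.
have : lead a * lead a <= lead y * lead b by rewrite ler_pM //; lra.
have : lead a * lead b <= lead y * lead b by rewrite ler_wpM2r //; lra.
have : lead a * lead y <= lead y * lead b by rewrite mulrC ler_wpM2l //; lra.
by lra.
Qed.

Lemma quadval_bracket_le (y a b : point) : positive a -> dev a <= 16^-1 ->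
  `|quadval (bracket y a b)| <= 3 * xi_bound ^+ 2 * (lead a * dev y * dev b).
Proof.
move=> a_pos da; rewrite quadval_bracket normrM normr_nat.
have lead_norm : `|lead a| <= lead a by rewrite norm_lead.
have da1 := le_trans (dev1_le a) da.
have qa : `|quadval a| <= xi_bound * 16^-1.
  by apply: le_trans (quadval_le a) _; rewrite ler_pM2l //; have := xi_bound_ge2; lra.
have := normrM_le (normrM_le lead_norm (quadval_le y)) (quadval_le b).
move/normrB_le => /(_ _ _ (normrM_le (normrM_le (dev1_le y) da1) (quadval_le b))).
move/normrB_le => /(_ _ _ (normrM_le (normrM_le (dev1_le b) da1) (quadval_le y))).
move/normrD_le => /(_ _ _ (normrM_le (normrM_le (dev1_le y) (dev1_le b)) qa)).
have dydb_ge0 : 0 <= dev y * dev b by rewrite mulr_ge0 ?dev_ge0.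
have dydb_le : dev y * dev b <= lead a * dev y * dev b.
  by rewrite -mulrA ler_peMl // lead_ge1.
have : 0 <= xi_bound * (dev y * dev b) <= 2^-1 * xi_bound ^+ 2 * (lead a * dev y * dev b).
  have := xi_bound_ge2; have := xi_bound_sqr_ge => ? ?.
  by apply/andP; split; [apply: mulr_ge0 | apply: ler_pM] => //; lra.
by rewrite expr2; lra.
Qed.

Lemma quadval_det_ge (y z : point) : positive y -> positive z ->
  2^-1 <= lead y * `|quadval y| ->
  4 * xi_bound * (lead y ^+ 2 * dev z) <= lead z ->
  lead z <= 4 * lead y * `|lead z * quadval y - lead y * quadval z|.
Proof.
move=> y_pos z_pos y_quad z_large.
have dist := lerB_dist (lead z * quadval y) (lead y * quadval z).
have {}dist := ler_wpM2l (ltW (lead_gt0 y_pos)) dist.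
rewrite !normrM !norm_lead // in dist.
have y_part : lead z * 2^-1 <= lead z * (lead y * `|quadval y|).
  by rewrite ler_pM2l ?lead_gt0.
have z_part : lead y ^+ 2 * `|quadval z| <= lead y ^+ 2 * (xi_bound * dev z).
  by rewrite ler_wpM2l ?sqr_ge0 ?quadval_le.
by move: dist y_part z_part z_large; rewrite expr2; lra.
Qed.

(* For p = bracket y a b, a direct estimate of dev1 p only gives
   lead y * dev a * dev b; coplanarity is what makes it small. *)
Lemma coplanar_dev_le (p y z : point) : positive y -> positive z ->
  2^-1 <= lead y * `|quadval y| ->
  4 * xi_bound * (lead y ^+ 2 * dev z) <= lead z -> det3 p y z = 0 ->
  dev p <= 8 * xi_bound ^+ 2 * (`|lead p| * lead y * dev y * dev z / lead z) +
           10 * xi_bound * (lead y * dev y * `|quadval p|).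
Proof.
move=> y_pos z_pos y_quad z_large coplanar.
have Y_gt0 := lead_gt0 y_pos; have Z_gt0 := lead_gt0 z_pos; have C_ge2 := xi_bound_ge2.
have YdY_ge : 1 <= 2 * xi_bound * (lead y * dev y).
  have : lead y * `|quadval y| <= lead y * (xi_bound * dev y).
    by rewrite ler_pM2l // quadval_le.
  by lra.
have cross_le : lead y * dev z <= lead z * dev y.
  rewrite -(ler_pM2l (_ : 0 < 4 * xi_bound * lead y)); last by rewrite !mulr_gt0; lra.
  have : lead z * 1 <= lead z * (2 * xi_bound * (lead y * dev y)) by rewrite ler_pM2l.
  have : 0 <= lead y * dev y * lead z * xi_bound by rewrite !mulr_ge0 ?dev_ge0; lra.
  by move: z_large; rewrite expr2; lra.
have det_le := normrB_le
  (normrM_le (lexx `|lead p|)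
    (normrB_le (normrM_le (dev1_le z) (quadval_le y)) (normrM_le (dev1_le y) (quadval_le z))))
  (normrM_le (lexx `|quadval p|)
    (normrB_le (normrM_le (lexx `|lead y|) (dev1_le z))
               (normrM_le (lexx `|lead z|) (dev1_le y)))).
rewrite -det3_eq0_dev1E // normrM (norm_lead y_pos) (norm_lead z_pos) in det_le.
have d1_le : `|dev1 p| <= 8 * xi_bound * (`|lead p| * lead y * dev y * dev z / lead z) +
    8 * (lead y * dev y) * `|quadval p|.
  rewrite -(ler_pM2r Z_gt0) [leRHS]mulrDl -[X in _ <= X + _]mulrA divfK ?gt_eqF //.
  have := quadval_det_ge y_pos z_pos y_quad z_large.
  move=> /(ler_wpM2l (normr_ge0 (dev1 p))).
  have := ler_wpM2l (ltW Y_gt0) det_le.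
  have := ler_wpM2l (mulr_ge0 (ltW Y_gt0) (normr_ge0 (quadval p))) cross_le.
  by lra.
apply: le_trans (dev_le_dev1_quadval d1_le (lexx _)) _.
have : 1 * `|quadval p| <= 2 * xi_bound * (lead y * dev y) * `|quadval p|.
  by rewrite ler_wpM2r.
by rewrite expr2; lra.
Qed.

Lemma lead_bracket_bounds (y a b : point) :
  positive y -> positive a -> positive b ->
  dev y <= 16^-1 -> dev a <= 16^-1 -> dev b <= 16^-1 -> symdet a != 0 ->
  lead a <= lead y -> lead a <= lead b ->
  0 < `|lead (bracket y a b)| <= 3 * xi_bound * (lead y * lead b * dev a).
Proof.
move=> y_pos a_pos b_pos dy da db a_det ay ab.
have yb_gt0 : 0 < lead y * lead b by rewrite mulr_gt0 ?lead_gt0.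
have main_gt0 : 0 < lead y * lead b * `|quadval a|.
  rewrite mulr_gt0 // -(pmulr_rgt0 _ (lead_gt0 a_pos)).
  by have := lead_quadval_ge a_pos da a_det; lra.
have main_norm : `|2 * (lead y * lead b * quadval a)| = 2 * (lead y * lead b * `|quadval a|).
  by rewrite 2!normrM normr_nat (gtr0_norm yb_gt0).
have approx := lead_bracket_approx y_pos a_pos b_pos dy da db a_det ay ab.
apply/andP; split.
  rewrite distrC in approx; have := le_trans (lerB_dist _ _) approx.
  by rewrite main_norm; lra.
have := normrD_le approx (lexx `|2 * (lead y * lead b * quadval a)|).
rewrite subrK main_norm => /le_trans; apply.
have := ler_wpM2l (ltW yb_gt0) (quadval_le a); lra.
Qed.

Lemma dev_bracket_le (h y a b z : point) : positive y -> positive a -> positive z ->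
  dev y <= 16^-1 -> dev a <= 16^-1 -> symdet y != 0 ->
  4 * xi_bound * (lead y ^+ 2 * dev z) <= lead z ->
  point_neq0 h -> dot h y = 0 -> dot h a = 0 -> dot h b = 0 -> dot h z = 0 ->
  dev (bracket y a b) <= 30 * xi_bound ^+ 3 *
   (`|lead (bracket y a b)| * lead y * dev y * dev z / lead z +
    lead y * dev y * (lead a * dev y * dev b)).
Proof.
move=> y_pos a_pos z_pos dy da y_det z_large h_neq0 hy ha hb hz.
have coplanar : det3 (bracket y a b) y z = 0.
  exact: det3_eq0_normal h_neq0 (dot_bracket hy ha hb) hy hz.
have y_quad := lead_quadval_ge y_pos dy y_det.
apply: le_trans (coplanar_dev_le y_pos z_pos y_quad z_large coplanar) _.
have quad_le := quadval_bracket_le y b a_pos da.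
set t := `|lead (bracket y a b)| * _ * _ * _ / _.
have t_ge0 : 0 <= t by rewrite !mulr_ge0 ?dev_ge0 ?invr_ge0 ?(ltW (lead_gt0 _)).
have [_ _ cube_ge] := xi_bound_cube_ge.
rewrite [leRHS]mulrDr; apply: lerD.
  by rewrite ler_wpM2r //; have := sqr_ge0 xi_bound; lra.
have -> : 30 * xi_bound ^+ 3 * (lead y * dev y * (lead a * dev y * dev b)) =
    10 * xi_bound * (lead y * dev y * (3 * xi_bound ^+ 2 * (lead a * dev y * dev b))).
  by ring.
rewrite ler_wpM2l ?ler_wpM2l ?mulr_ge0 ?dev_ge0 ?(ltW (lead_gt0 _)) //.
by have := xi_bound_ge2; lra.
Qed.

Lemma exists_positive (q : point) : coord0 q != 0 ->
  exists p, [/\ positive p, coord0 p = `|coord0 q| & dev p = dev q].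
Proof.
move=> q_neq0; case: (ltrP 0 (coord0 q)) => [q_gt0|q_le0].
  by exists q; split; rewrite ?gtr0_norm.
exists (scale_point (-1) q); split.
- by rewrite /positive /= mulN1r oppr_gt0 lt_neqAle q_neq0.
- by rewrite ler0_norm //= mulN1r.
- by rewrite dev_scale normrN1 mul1r.
Qed.

Lemma exists_bracket_point (K : R) (h y a b z : point) : slack K ->
  positive y -> positive a -> positive b -> positive z ->
  4 <= lprec y -> 4 <= lprec a -> 4 <= lprec b -> symdet a != 0 -> symdet y != 0 ->
  lsize a <= lsize y -> lsize a <= lsize b -> 2 * lsize y - lprec z + K <= lsize z ->
  point_neq0 h -> dot h y = 0 -> dot h a = 0 -> dot h b = 0 -> dot h z = 0 ->
  exists p, [/\ positive p, lsize p <= lsize y + lsize b - lprec a + K &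
    lsize z + lprec y + lprec z - lsize y - lsize p <= lprec p + K \/
    2 * lprec y + lprec b - lsize a - lsize y <= lprec p + K].
Proof.
move=> K_slack y_pos a_pos b_pos z_pos /(dev_small y_pos) dy /(dev_small a_pos) da
  /(dev_small b_pos) db a_det y_det ay ab yz h_neq0 hy ha hb hz.
have [_ C_le _] := xi_bound_cube_ge; have C_ge2 := xi_bound_ge2.
have lead_le p q : positive p -> positive q -> lsize p <= lsize q -> lead p <= lead q.
  by move=> p_pos q_pos; rewrite !lead_expR // ler_expR.
have z_large : 4 * xi_bound * (lead y ^+ 2 * dev z) <= lead z.
  rewrite !lead_expR // dev_expR // -expRM_natl -expRD.
  apply: (le_trans (y := expR (K - 1 + (2 * lsize y - lprec z)))); last first.
    by rewrite ler_expR; lra.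
  by rewrite (expRD (K - 1)) ler_wpM2r ?expR_ge0 //; case: K_slack; lra.
have /andP[w_gt0 w_le] := lead_bracket_bounds y_pos a_pos b_pos dy da db a_det
  (lead_le _ _ a_pos y_pos ay) (lead_le _ _ a_pos b_pos ab).
have dev_w := dev_bracket_le y_pos a_pos z_pos dy da y_det z_large h_neq0 hy ha hb hz.
have [|p [p_pos lead_p dev_p]] := @exists_positive (bracket y a b).
  by rewrite -(intr_eq0 R) -normr_gt0.
move: w_le dev_w; rewrite -dev_p -[`|lead _|]intr_norm -lead_p -/(lead p).
rewrite !lead_expR // !dev_expR // -expRN -!expRD => size_p prec_p.
exists p; split => //.
  have := slack_ler K_slack _ size_p; lra.
by case: (slack_lerD K_slack _ prec_p) => [|?|?]; [lra | left; lra | right; lra].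
Qed.

Lemma exists_lsize_min (P : point -> Prop) : (exists2 p, positive p & P p) ->
  exists p, [/\ positive p, P p & forall q, positive q -> P q -> lsize p <= lsize q].
Proof.
move=> [p0 p0_pos Pp0].
pose occurs (n : nat) := `[< exists p, [/\ positive p, P p & coord0 p = n%:Z] >].
have occursP p : positive p -> P p -> occurs `|coord0 p|%N.
  by move=> p_pos Pp; apply/asboolP; exists p; split; rewrite ?gtz0_abs.
have ex_n : exists n, occurs n by exists `|coord0 p0|%N; exact: occursP.
case: (ex_minnP ex_n) => n /asboolP[p [p_pos Pp coord_p]] n_min.
exists p; split => // q q_pos Pq; rewrite leNgt lsize_lt // coord_p -leNgt.
by rewrite -(gtz0_abs q_pos) lez_nat n_min ?occursP.
Qed.

Lemma irrational_dist_ge (n : int) : n != 0 ->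
  exists2 c : R, 0 < c & forall m : int, c <= `|n%:~R * xi - m%:~R|.
Proof.
move=> n_neq0; set t := n%:~R * xi; have /andP[floor_le floor_gt] := floor_itv t.
have floor_lt : (Num.floor t)%:~R < t.
  by rewrite lt_neqAle floor_le andbT eq_sym -subr_eq0 irrational_dist_neq0.
exists (Num.min (t - (Num.floor t)%:~R) ((Num.floor t + 1)%:~R - t)).
  by rewrite lt_min !subr_gt0 floor_lt.
move=> m; rewrite ge_min; case: (lerP m (Num.floor t)) => m_floor; apply/orP; [left|right].
  have : m%:~R <= (Num.floor t)%:~R :> R by rewrite ler_int.
  by move=> ?; rewrite ger0_norm; lra.
have : (Num.floor t + 1)%:~R <= m%:~R :> R by rewrite ler_int; lia.
by move=> ?; rewrite ler0_norm; lra.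
Qed.

Lemma dev_ge_coord0_le (N : nat) :
  exists2 c : R, 0 < c & forall p, positive p -> coord0 p <= N%:Z -> c <= dev p.
Proof.
elim: N => [|N [c c_gt0 dev_ge_c]].
  by exists 1 => // p; rewrite /positive; lia.
have [//|c' c'_gt0 dist_ge_c'] := @irrational_dist_ge N.+1.
exists (Num.min c c') => [|p p_pos p_le]; first by rewrite lt_min c_gt0.
rewrite ge_min; apply/orP; case: (lerP (coord0 p) N%:Z) => p_N; [left|right].
  exact: dev_ge_c.
have p_eq : coord0 p = N.+1 by lia.
by apply: le_trans (dev1_le p); rewrite /dev1 p_eq.
Qed.

Lemma lprec_bounded (S : R) :
  exists M : R, forall p, positive p -> lsize p <= S -> lprec p <= M.
Proof.
have [c c_gt0 dev_ge_c] := dev_ge_coord0_le (Num.truncn (expR S)).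
exists (- ln c) => p p_pos p_le; rewrite lerN2 ler_ln ?posrE ?dev_gt0 //.
apply: dev_ge_c => //; rewrite -ltzD1 -(ltr_int R).
apply: (le_lt_trans (y := expR S)); first by rewrite -/(lead p) lead_expR // ler_expR.
by rewrite addrC -intS; exact: truncnS_gt.
Qed.

(** * Uniform approximation *)

(* Equivalently, dev p <= lead p `^ (eta - 1). *)
Definition admissible (eta : R) (p : point) : Prop :=
  positive p /\ (1 - eta) * lsize p <= lprec p.

Lemma admissible_le (eta eta' : R) (p : point) :
  eta <= eta' -> admissible eta p -> admissible eta' p.
Proof.
move=> eta_le [p_pos p_prec]; split => //; apply: le_trans p_prec.
by rewrite ler_wpM2r ?lsize_ge0 // lerD2l lerN2.
Qed.

(* w is the inverse of the exponent b of beta_set. *)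
Definition uniform (w : R) : Prop := forall eta : R, 0 < eta < 1 ->
  exists T0 : R, forall T, T0 <= T ->
  exists p, [/\ admissible eta p, lsize p < T & w * T - 1 <= lprec p].

Lemma uniform_lprec_gt (w eta t : R) : uniform w -> 0 < w -> 0 < eta < 1 ->
  exists2 p, admissible eta p & t < lprec p.
Proof.
move=> w_unif w_gt0 /w_unif [T0 approx].
have [|p [p_adm _ p_prec]] := approx (Num.max T0 ((t + 2) / w)).
  by rewrite le_max lexx.
exists p => //; apply: lt_le_trans p_prec; rewrite ltrBrDr.
apply: (lt_le_trans (y := w * ((t + 2) / w))); first by rewrite mulrC divfK ?gt_eqF //; lra.
by rewrite ler_pM2l // le_max lexx orbT.
Qed.

Definition consecutive (w eta eta' t : R) (y z : point) : Prop :=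
  [/\ admissible eta y, admissible eta' z, lsize y < lsize z
    & w * lsize z - 1 <= lprec y] /\
  [/\ lprec y <= t, t < lprec z
    & forall p, admissible eta' p -> lsize p < lsize z -> lprec p <= t].

Lemma uniform_consecutive (w eta eta' : R) :
  uniform w -> 0 < w -> 0 < eta < 1 -> eta <= eta' ->
  exists t0 : R, forall t, t0 <= t -> exists y z, consecutive w eta eta' t y z.
Proof.
move=> w_unif w_gt0 eta01 eta_le; have [T0 approx] := w_unif _ eta01.
have [t0 small_bounded] := lprec_bounded T0.
exists t0 => t t_ge.
have [|z [z_pos [z_adm z_prec] z_min]] :=
    @exists_lsize_min (fun p => admissible eta' p /\ t < lprec p).
  have [p p_adm p_prec] := uniform_lprec_gt t w_unif w_gt0 eta01.
  by exists p; [exact: p_adm.1 | split=> //; exact: admissible_le p_adm].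
have z_first p : admissible eta' p -> lsize p < lsize z -> lprec p <= t.
  move=> p_adm p_lt; rewrite leNgt; apply/negP => p_prec.
  by have := z_min p p_adm.1 (conj p_adm p_prec); rewrite leNgt p_lt.
have z_large : T0 <= lsize z.
  rewrite leNgt; apply/negP => /ltW /(small_bounded z z_pos) z_prec_le.
  by have := lt_le_trans z_prec (le_trans z_prec_le t_ge); rewrite ltxx.
have [y [y_adm y_lt y_prec]] := approx _ z_large.
by exists y, z; split; split => //; apply: z_first => //; exact: admissible_le y_adm.
Qed.

Lemma veronese_minor_ge1 (m n : int) (z : point) :
  0 < m -> coprimez m n -> positive z -> coord0 z < m * m -> dev z <= 1 ->
  1 <= xi_bound * (m%:~R * dev z + lead z * `|m%:~R * xi - n%:~R|).
Proof.
move=> m_gt0 mn_coprime z_pos z_lt dev_le1.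
set delta := `|_ - _|; have z_ge1 := lead_ge1 z_pos; have xi_ge0 := normr_ge0 xi.
have m_ge0 : 0 <= m%:~R :> R by rewrite ler0z ltW.
have m_dev_ge0 : 0 <= m%:~R * dev z by rewrite mulr_ge0 ?dev_ge0.
have z_delta_ge0 : 0 <= lead z * delta by rewrite mulr_ge0 ?normr_ge0 //; lra.
have norm_m : `|m%:~R| = m%:~R :> R by rewrite ger0_norm.
have coord1_le : `|(coord1 z)%:~R| <= (`|xi| + 1) * lead z.
  have -> : (coord1 z)%:~R = lead z * xi - dev1 z by rewrite /lead /dev1; ring.
  have := normrB_le (normrM_le (lexx `|lead z|) (lexx `|xi|)) (dev1_le z).
  by rewrite norm_lead //; lra.
have minor1_le : `|(m * coord1 z - n * coord0 z)%:~R| <= lead z * delta + m%:~R * dev z.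
  have -> : (m * coord1 z - n * coord0 z)%:~R =
      lead z * (m%:~R * xi - n%:~R) - m%:~R * dev1 z by rewrite /lead /dev1; ring.
  have := normrB_le (normrM_le (lexx `|lead z|) (lexx delta))
    (normrM_le (lexx `|m%:~R|) (dev1_le z)).
  by rewrite norm_m norm_lead.
have minor2_le : `|(m * coord2 z - n * coord1 z)%:~R| <=
    (`|xi| + 1) * (m%:~R * dev z + lead z * delta).
  have -> : (m * coord2 z - n * coord1 z)%:~R = m%:~R * (xi * dev1 z - dev2 z)
      + (m%:~R * xi - n%:~R) * (coord1 z)%:~R by rewrite /dev1 /dev2; ring.
  have := normrD_le (normrM_le (lexx `|m%:~R|)
      (normrB_le (normrM_le (lexx `|xi|) (dev1_le z)) (dev2_le z)))
    (normrM_le (lexx delta) coord1_le).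
  by rewrite norm_m; lra.
have xi_part : 0 <= `|xi| * (m%:~R * dev z + lead z * delta).
  by rewrite mulr_ge0 ?addr_ge0.
case/orP: (veronese_minor_neq0 m_gt0 mn_coprime z_pos z_lt) => /(normr_int_ge1 R);
  by rewrite /xi_bound; lra.
Qed.

Section UniformApproximation.
Hypothesis xi_nonquadratic : non_quadratic xi.
Variable e : R.
Hypothesis e_gt0 : 0 < e.
Hypothesis e_le : e <= 1 / 6.
Hypothesis xi_uniform : uniform (1 / 2 + e).

Lemma half_plus_e_gt0 : 0 < 1 / 2 + e.
Proof. by move: e_gt0; lra. Qed.

Lemma uniform_quarter : exists T0 : R, forall T, T0 <= T ->
  exists p, [/\ admissible (1 / 4) p, lsize p < T & (1 / 2 + e) * T - 1 <= lprec p].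
Proof. by apply: xi_uniform; apply/andP; split; lra. Qed.

Lemma veronese_lsize_bounded : exists S : R, forall m n : int,
  0 < m -> coprimez m n -> admissible (1 / 4) (veronese m n) ->
  lsize (veronese m n) <= S.
Proof.
have [T0 approx] := uniform_quarter; have [K K_slack _] := exists_slack 0.
exists (Num.max T0 (K / e)) => m n m_gt0 mn_coprime [q_pos q_prec].
set q := veronese m n in q_pos q_prec *; rewrite leNgt; apply/negP.
rewrite gt_max ltr_pdivrMr // => /andP[/ltW size_T0 size_large].
have [z [[z_pos z_adm] z_lt z_prec]] := approx _ size_T0.
have z_ge0 := lsize_ge0 z_pos.
have mR_gt0 : 0 < m%:~R :> R by rewrite ltr0z.
have mE : m%:~R = expR (lsize q / 2).
  suff -> : lsize q = 2 * ln (m%:~R : R) by rewrite mulrAC divff // mul1r lnK.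
  by rewrite /lsize /lead /= rmorphM lnM ?posrE //=; ring.
have dev_le1 : dev z <= 1 by rewrite dev_expR // -[leRHS]expR0 ler_expR; lra.
rewrite lsize_lt // in z_lt.
have := veronese_minor_ge1 m_gt0 mn_coprime z_pos z_lt dev_le1.
set delta := `|_ - _|.
have dev_part : m%:~R * dev z <= expR (1 - e * lsize q).
  by rewrite mE dev_expR // -expRD ler_expR; lra.
have delta_part : lead z * delta <= expR (1 - e * lsize q).
  have m_delta : m%:~R * delta <= expR (- lprec q).
    rewrite -(dev_expR q_pos); apply: le_trans (dev1_le q).
    by rewrite -{1}(gtr0_norm mR_gt0) -normrM /dev1 /= !intrM mulrBr mulrA.
  have lead_le : lead z <= m%:~R * m%:~R by rewrite -intrM ler_int ltW.
  apply: (le_trans (y := m%:~R * expR (- lprec q))); last first.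
    have : e * lsize q <= 1 / 6 * lsize q by rewrite ler_wpM2r // lsize_ge0.
    have := lsize_ge0 q_pos.
    by rewrite mE -expRD ler_expR; lra.
  apply: le_trans (ler_wpM2r _ lead_le) _; first exact: normr_ge0.
  by rewrite -mulrA ler_pM2l.
have C_ge2 := xi_bound_ge2; have [_ C_le _] := xi_bound_cube_ge => minor_ge1.
have : 0 <= K - 1 + (1 - e * lsize q).
  apply: (slack_ler (c := 2 * xi_bound) K_slack); first by lra.
  rewrite expR0; apply: le_trans minor_ge1 _.
  by rewrite [2 * _]mulrC -mulrA ler_pM2l; lra.
by lra.
Qed.

Lemma symdet_neq0_large :
  exists S : R, forall p, admissible (1 / 4) p -> S <= lsize p -> symdet p != 0.
Proof.
have [S veronese_small] := veronese_lsize_bounded; have [M prec_le] := lprec_bounded S.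
exists (4 / 3 * M + 1) => p [p_pos p_adm] p_large; apply/negP => /eqP.
case/(symdet_eq0_veronese p_pos) => c [m [n [c_gt0 m_gt0 mn_coprime pE]]].
have q_pos : positive (veronese m n) by rewrite /positive mulr_gt0.
have cR_ge1 : 1 <= c%:~R :> R by rewrite (ler_int R 1).
have prec_pq : lprec p <= lprec (veronese m n).
  rewrite lerN2 ler_ln ?posrE ?dev_gt0 // pE dev_scale gtr0_norm //.
  by rewrite ler_peMl ?dev_ge0.
have size_qp : lsize (veronese m n) <= lsize p.
  rewrite ler_ln ?posrE ?lead_gt0 // pE /lead /= [leRHS]intrM ler_peMl //.
  exact: ltW (lead_gt0 q_pos).
have q_adm : admissible (1 / 4) (veronese m n) by split => //; lra.
have := prec_le _ q_pos (veronese_small m n m_gt0 mn_coprime q_adm).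
by lra.
Qed.

Definition plane_gap (S : R) : Prop := forall y h : point,
  admissible (1 / 4) y -> S <= lsize y -> 0 < plane_height h -> dot h y = 0 ->
  e / 2 * lsize y <= ln (plane_height h).

Lemma exists_off_plane (eta : R) (h : point) (t : R) : 0 < eta < 1 ->
  0 < plane_height h -> exists p, [/\ admissible eta p, dot h p != 0 & t < lprec p].
Proof.
move=> eta01 h_gt0; set H := ln (plane_height h).
have form_gt0 : 0 < `|linear_form xi h|.
  rewrite normr_gt0.
  exact: non_quadratic_linear_form_neq0 xi_irr xi_nonquadratic (plane_height_gt0 h_gt0).
have [p p_adm p_prec] :=
  uniform_lprec_gt (Num.max t (H - ln `|linear_form xi h|)) xi_uniform half_plus_e_gt0 eta01.
have [p_pos _] := p_adm; move: p_prec; rewrite gt_max => /andP[p_t p_form].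
exists p; split => //; apply/negP => /eqP hp.
have : `|linear_form xi h| <= plane_height h * dev p.
  by apply: le_trans (on_plane_linear_form_le p_pos hp); rewrite ler_peMl // lead_ge1.
rewrite -{1}(lnK (form_gt0 : _ \in Num.pos)) -(lnK (h_gt0 : _ \in Num.pos)).
by rewrite dev_expR // -expRD ler_expR -/H; lra.
Qed.

(* Let s be the smallest point of precision > lsize y / 2 off the plane, and t
   an approximation just below s. If t is in the plane, then dot h s is at most
   about plane_height h * exp (lsize s - lprec t - lsize t), with a negative
   exponent; otherwise s is small compared with y, which takes the role of t. *)
Lemma exists_plane_gap (K : R) : slack K ->
  (forall p, admissible (1 / 4) p -> lprec p <= lsize p + K) ->
  exists S : R, plane_gap S.
Proof.
move=> K_slack prec_le; have [K_ge1 _] := K_slack; have [T0 approx] := uniform_quarter.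
exists (Num.max (10 * K / e) (2 * (T0 + K))) => y h y_adm.
rewrite ge_max ler_pdivrMr // => /andP[y_large y_T0] h_gt0 hy.
have [y_pos y_prec] := y_adm; have e_pos := e_gt0; have y_ge0 := lsize_ge0 y_pos.
have e_small t : 0 <= t -> 0 <= e * t <= 1 / 6 * t.
  by move=> t_ge0; rewrite mulr_ge0 ?ler_wpM2r // ltW.
have /andP[_ ey_le] := e_small _ y_ge0; set H := ln (plane_height h).
have [|s [s_pos [s_adm hs s_prec] s_min]] := @exists_lsize_min
    (fun p => [/\ admissible (1 / 4) p, dot h p != 0 & lsize y / 2 < lprec p]).
  have [|p [p_adm hp p_prec]] := @exists_off_plane (1 / 4) h (lsize y / 2) _ h_gt0.
    by apply/andP; split; lra.
  by exists p => //; exact: p_adm.1.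
have s_size : lsize y / 2 - K < lsize s by have := prec_le _ s_adm; lra.
have [|t [t_adm t_lt t_prec]] := approx (lsize s); first by lra.
have [t_pos _] := t_adm; have t_size := prec_le _ t_adm.
have es_ge : e * (lsize y / 2 - K) <= e * lsize s by rewrite ler_pM2l // ltW.
have /andP[_ eK_le] := e_small K (le_trans ler01 K_ge1).
have [ht|ht] := eqVneq (dot h t) 0.
  by have := off_plane_log K_slack s_pos t_pos hs ht; rewrite -/H; case; lra.
have t_prec_le : lprec t <= lsize y / 2.
  rewrite leNgt; apply/negP => t_prec_gt.
  by have := s_min t t_pos (And3 t_adm ht t_prec_gt); rewrite leNgt t_lt.
have /andP[es_ge0 _] := e_small _ (lsize_ge0 s_pos).
by have := off_plane_log K_slack s_pos y_pos hs hy; rewrite -/H; case; lra.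
Qed.

(* K collects the errors, and the size above which the estimates hold. *)
Definition uniform_slack (K : R) : Prop :=
  [/\ slack K, forall p, admissible (1 / 4) p -> lprec p <= lsize p + K,
      forall p, admissible (1 / 4) p -> K <= lsize p -> symdet p != 0
    & plane_gap K].

Lemma admissible_lprec_le :
  exists C : R, forall p, admissible (1 / 4) p -> lprec p <= lsize p + C.
Proof.
have [S symdet_neq0] := symdet_neq0_large; have [M small_bounded] := lprec_bounded S.
have [K K_slack K_ge] := exists_slack M.
exists K => p p_adm; have [p_pos p_prec] := p_adm; have p_ge0 := lsize_ge0 p_pos.
case: (lerP S (lsize p)) => p_S.
  by apply: symdet_neq0_log (symdet_neq0 _ p_adm p_S) => //; lra.
by have := small_bounded p p_pos (ltW p_S); lra.
Qed.

Lemma exists_uniform_slack (M : R) : exists2 K : R, uniform_slack K & M <= K.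
Proof.
have [S symdet_neq0] := symdet_neq0_large; have [C prec_le] := admissible_lprec_le.
have [K1 K1_slack C_le] := exists_slack C.
have [|G gap] := exists_plane_gap K1_slack; first by move=> p /prec_le; lra.
have [K K_slack] := exists_slack (Num.max M (Num.max S (Num.max C G))).
rewrite !ge_max => /and4P[M_le S_le C_le' G_le].
exists K => //; split => // [p /prec_le|p p_adm p_K|y h y_adm y_K].
- by lra.
- by apply: symdet_neq0 => //; lra.
- by apply: gap => //; lra.
Qed.

(** * Improving an isolated approximation *)

Section Improvement.
Variables (K eps eta : R).
Hypothesis K_slack : uniform_slack K.
Hypothesis eps_le : eps <= e * e / 8.
Hypothesis eta_gt0 : 0 < eta.
Hypothesis eta_le : eta <= e * e / 200.

Lemma exponents_small : [/\ e * e <= 1 / 36, eps <= 1 / 4 & 6 * eta <= 1 / 4].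
Proof.
suff : e * e <= 1 / 36 by move: eps_le eta_le; split; lra.
have -> : 1 / 36 = 1 / 6 * (1 / 6) :> R by field.
by apply: ler_pM; rewrite ?(ltW e_gt0).
Qed.

Section Flanked.
Variables x y z : point.
Hypothesis x_adm : admissible eps x.
Hypothesis y_adm : admissible eta y.
Hypothesis z_adm : admissible (6 * eta) z.
Hypothesis yx_size : lsize y < lsize x.
Hypothesis xz_size : lsize x < lsize z.
Hypothesis yx_prec : lprec y <= lprec x.
Hypothesis xz_prec : lprec x < lprec z.
Hypothesis yz_uniform : (1 / 2 + e) * lsize z - 1 <= lprec y.
Hypothesis x_large : 500 * K <= e * e * (eta * lsize x).

Local Notation spread := (lsize z - lprec y).

Lemma error_scale :
  [/\ 1 <= K, 500 * K <= eta * lsize x,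
      200 * (eta * lsize x) <= e * (e * lsize x),
      6 * (e * (e * lsize x)) <= e * lsize x & 6 * (e * lsize x) <= lsize x].
Proof.
have [[K_ge1 _] _ _ _] := K_slack; have x_ge0 := lsize_ge0 x_adm.1.
have [ee_le _ _] := exponents_small.
have eta_x_ge0 : 0 <= eta * lsize x by rewrite mulr_ge0 // ltW.
have e_mul t : 0 <= t -> 6 * (e * t) <= t.
  by move=> t_ge0; have := ler_wpM2r t_ge0 e_le; lra.
split=> //; try by rewrite e_mul ?mulr_ge0 ?(ltW e_gt0).
- by apply: le_trans x_large _; rewrite ler_piMl //; lra.
- by have := ler_wpM2r x_ge0 eta_le; lra.
Qed.

Lemma left_admissible : admissible (1 / 4) y.
Proof.
have [_ _ eta_small] := exponents_small.
by apply: admissible_le y_adm; move: eta_gt0; lra.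
Qed.

Lemma lsize_left_ge : lsize x / 2 + e * lsize x - 1 - K <= lsize y.
Proof.
have [_ prec_le _ _] := K_slack; have y_adm4 := left_admissible.
have := prec_le y y_adm4; have := ler_wpM2l (ltW e_gt0) (ltW xz_size).
by move: yz_uniform xz_size; lra.
Qed.

Lemma lsize_right_le : lsize z <= 3 * lsize x.
Proof.
have [_ prec_le _ _] := K_slack; have y_adm4 := left_admissible.
have [K_ge1 K_small eta_small e2_small e_small] := error_scale.
have := prec_le y y_adm4; have := ler_wpM2l (ltW e_gt0) (ltW xz_size).
by move: yz_uniform yx_size; lra.
Qed.

Lemma flank_coplanar : det3 y x z = 0.
Proof.
have [slackK _ _ _] := K_slack.
have [K_ge1 K_small eta_small e2_small e_small] := error_scale.
apply/eqP/negPn/negP => det_neq0.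
have sizes : lsize y <= lsize x <= lsize z by rewrite !ltW.
have precs : lprec y <= lprec x <= lprec z by rewrite yx_prec ltW.
have := det3_neq0_log slackK y_adm.1 x_adm.1 z_adm.1 sizes precs det_neq0.
have := ler_wpM2l (ltW e_gt0) (ltW xz_size).
by move: yz_uniform yx_prec; lra.
Qed.

Lemma spread_ge : e / 2 * lsize y <= spread + K.
Proof.
have [slackK _ _ gap] := K_slack; have y_adm4 := left_admissible.
have [K_ge1 K_small eta_small e2_small e_small] := error_scale.
have yz_size := lt_trans yx_size xz_size; have yz_prec := le_trans yx_prec (ltW xz_prec).
have y_large : K <= lsize y by have := lsize_left_ge; lra.
have := gap y _ y_adm4 y_large
  (plane_height_cross_gt0 y_adm.1 z_adm.1 yz_size yz_prec) (dot_crossl y z).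
by have := ln_plane_height_cross_le slackK y_adm.1 z_adm.1 yz_size yz_prec; lra.
Qed.

Lemma spread_le : spread <= lsize z / 2 - e * lsize z + 1.
Proof. by move: yz_uniform; lra. Qed.

Lemma e_spread_ge : e * (e * lsize x) / 4 - K <= e * spread.
Proof.
have [K_ge1 K_small eta_small e2_small e_small] := error_scale.
have y_ge : lsize x / 2 <= lsize y by have := lsize_left_ge; lra.
have e2_ge0 : 0 <= e / 2 by move: e_gt0; lra.
have := ler_wpM2l (ltW e_gt0) (le_trans (ler_wpM2l e2_ge0 y_ge) spread_ge).
have := ler_wpM2r (le_trans ler01 K_ge1) e_le.
by lra.
Qed.

Lemma spread_large : 100 * K <= spread.
Proof.
have [K_ge1 K_small eta_small e2_small e_small] := error_scale.
have e_spread := e_spread_ge.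
have spread_ge0 : 0 <= spread by rewrite -(pmulr_rge0 _ e_gt0); lra.
by have := ler_wpM2r spread_ge0 e_le; lra.
Qed.

Lemma exists_low_plane : exists h,
  [/\ 0 < plane_height h, dot h y = 0, dot h z = 0 &
      ln (plane_height h) <= spread / 2 + e * (e * lsize x) / 16 + K].
Proof.
have [slackK _ _ _] := K_slack; have [x_pos x_prec] := x_adm.
have x_defect : lsize x - lprec x <= e * (e * lsize x) / 8.
  by have := ler_wpM2r (lsize_ge0 x_pos) eps_le; lra.
have yx_height := ln_plane_height_cross_le slackK y_adm.1 x_pos yx_size yx_prec.
have xz_height := ln_plane_height_cross_le slackK x_pos z_adm.1 xz_size (ltW xz_prec).
have [yx_xz|xz_yx] := lerP (ln (plane_height (cross y x))) (ln (plane_height (cross x z))).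
  exists (cross y x); rewrite dot_crossl -/(det3 y x z) flank_coplanar.
  by split => //; [exact: plane_height_cross_gt0 y_adm.1 x_pos yx_size yx_prec | lra].
exists (cross x z); rewrite dot_crossr -/(det3 x z y) -det3_rot flank_coplanar.
split => //; [|lra].
exact: plane_height_cross_gt0 x_pos z_adm.1 xz_size (ltW xz_prec).
Qed.

Section LowPlane.
Variable h : point.
Hypothesis h_gt0 : 0 < plane_height h.
Hypothesis hy : dot h y = 0.
Hypothesis hz : dot h z = 0.
Hypothesis h_low : ln (plane_height h) <= spread / 2 + e * (e * lsize x) / 16 + K.

Lemma on_low_plane (p : point) : positive p -> lsize p <= 2 * spread + 2 ->
  spread / 2 + e * (e * lsize x) / 16 + 2 * K < lprec p -> dot h p = 0.
Proof.
move=> p_pos p_size p_prec; have [slackK _ _ _] := K_slack.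
have [K_ge1 K_small eta_small e2_small e_small] := error_scale.
apply/eqP/negPn/negP => hp.
case: (off_plane_log slackK p_pos z_adm.1 hp hz); last by move: h_low; lra.
have [_ z_prec] := z_adm; have := spread_le.
have := ler_wpM2l (ltW eta_gt0) lsize_right_le.
have := ler_wpM2l (ltW e_gt0) (ltW xz_size).
by move: h_low xz_size; lra.
Qed.

Variables a b : point.
Hypothesis a_adm : admissible eta a.
Hypothesis b_adm : admissible eta b.
Hypothesis ab_size : lsize a < lsize b.
Hypothesis ab_uniform : (1 / 2 + e) * lsize b - 1 <= lprec a.
Hypothesis a_prec_le : lprec a <= spread.
Hypothesis b_prec_gt : spread < lprec b.

Lemma inner_admissible : admissible (1 / 4) a /\ admissible (1 / 4) b.
Proof.
have [_ _ eta_small] := exponents_small.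
by split; [apply: admissible_le a_adm | apply: admissible_le b_adm]; move: eta_gt0; lra.
Qed.

Lemma e_lsize_inner_ge : e * (e * lsize x) / 4 - 2 * K <= e * lsize b.
Proof.
have [[K_ge1 _] prec_le _ _] := K_slack; have [_ b_adm4] := inner_admissible.
have b_size : spread - K <= lsize b by have := prec_le b b_adm4; move: b_prec_gt; lra.
have := ler_wpM2l (ltW e_gt0) b_size; have := e_spread_ge.
by have := ler_wpM2r (le_trans ler01 K_ge1) e_le; lra.
Qed.

Lemma lsize_inner_le : lsize b <= 2 * lprec a + 2 - 2 * (e * lsize b).
Proof. by move: ab_uniform; lra. Qed.

Lemma lprec_inner_ge : spread / 2 + e * (e * lsize x) / 4 - 4 * K <= lprec a.
Proof.
have [[K_ge1 _] prec_le _ _] := K_slack; have [_ b_adm4] := inner_admissible.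
have := prec_le b b_adm4; have := e_lsize_inner_ge.
by move: ab_uniform b_prec_gt; lra.
Qed.

Lemma lsize_inner_le_spread : lsize b <= 2 * spread + 2.
Proof.
have [K_ge1 K_small eta_small e2_small e_small] := error_scale.
by have := lsize_inner_le; have := e_lsize_inner_ge; move: a_prec_le; lra.
Qed.

Lemma eta_lsize_inner_le : eta * lsize a <= eta * lsize b <= 4 * (eta * lsize x).
Proof.
have [K_ge1 K_small eta_small e2_small e_small] := error_scale.
have b_size : lsize b <= 4 * lsize x.
  have := ler_wpM2l (ltW e_gt0) (ltW xz_size).
  by have := lsize_inner_le_spread; have := spread_le; have := lsize_right_le; lra.
have := ler_wpM2l (ltW eta_gt0) b_size; have := ler_wpM2l (ltW eta_gt0) (ltW ab_size).
by move=> *; apply/andP; split; lra.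
Qed.

Lemma inner_on_plane : dot h a = 0 /\ dot h b = 0.
Proof.
have [K_ge1 K_small eta_small e2_small e_small] := error_scale.
have b_size := lsize_inner_le_spread.
have a_prec := lprec_inner_ge.
split; apply: on_low_plane; [exact: a_adm.1 | | | exact: b_adm.1 | by [] |].
- by move: ab_size; lra.
- by lra.
- by move: a_prec_le b_prec_gt; lra.
Qed.

Lemma inner_gap : e / 2 * lsize y <= lsize b - lprec a + K.
Proof.
have [slackK _ _ gap] := K_slack; have y_adm4 := left_admissible.
have [K_ge1 K_small eta_small e2_small e_small] := error_scale.
have ab_prec : lprec a <= lprec b by exact: le_trans a_prec_le (ltW b_prec_gt).
have y_large : K <= lsize y by have := lsize_left_ge; lra.
have [ha hb] := inner_on_plane.
have aby : det3 a b y = 0 := det3_eq0_normal (plane_height_gt0 h_gt0) ha hb hy.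
have := gap y _ y_adm4 y_large
  (plane_height_cross_gt0 a_adm.1 b_adm.1 ab_size ab_prec) aby.
by have := ln_plane_height_cross_le slackK a_adm.1 b_adm.1 ab_size ab_prec; lra.
Qed.

Lemma lsize_inner_le_left : lsize a <= lsize y.
Proof.
have [K_ge1 K_small eta_small e2_small e_small] := error_scale.
have [_ prec_le _ _] := K_slack; have y_adm4 := left_admissible.
have y_size := prec_le y y_adm4; have [_ a_prec] := a_adm.
have /andP[eta_a eta_b] := eta_lsize_inner_le; have s_le := spread_le.
have := ler_wpM2l (ltW e_gt0) (ltW xz_size).
by move: a_prec_le yz_uniform; lra.
Qed.

Lemma flank_size_gap : e / 8 * lsize x <= lsize z - lsize y.
Proof.
have [K_ge1 K_small eta_small e2_small e_small] := error_scale.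
have [_ y_prec] := y_adm; have y_ge := lsize_left_ge.
have y_half : lsize x / 2 - 2 * K <= lsize y by lra.
have := ler_wpM2l (ltW e_gt0) y_half; have := ler_wpM2l (ltW eta_gt0) (ltW yx_size).
by have := ler_wpM2r (le_trans ler01 K_ge1) e_le; have := spread_ge; lra.
Qed.

Lemma exists_inner_bracket : exists p,
  [/\ positive p, lsize p <= lsize y + lsize b - lprec a + K &
    lsize z + lprec y + lprec z - lsize y - lsize p <= lprec p + K \/
    2 * lprec y + lprec b - lsize a - lsize y <= lprec p + K].
Proof.
have [slackK prec_le symdet_neq0 _] := K_slack.
have [K_ge1 K_small eta_small e2_small e_small] := error_scale.
have spread_ge := spread_large.
have y_adm4 := left_admissible; have [a_adm4 _] := inner_admissible.
have [ha hb] := inner_on_plane; have ay := lsize_inner_le_left.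
have a_prec := lprec_inner_ge; have a_size := prec_le a a_adm4.
have a_large : K <= lsize a by lra.
have y_large := le_trans a_large ay.
have yz_size : 2 * lsize y - lprec z + K <= lsize z.
  have [_ z_prec] := z_adm; have := flank_size_gap.
  by have := ler_wpM2l (ltW eta_gt0) lsize_right_le; lra.
apply: (exists_bracket_point slackK y_adm.1 a_adm.1 b_adm.1 z_adm.1 _ _ _
  (symdet_neq0 a a_adm4 a_large) (symdet_neq0 y y_adm4 y_large) ay (ltW ab_size) yz_size
  (plane_height_gt0 h_gt0) hy ha hb hz).
- have := ler_wpM2l (ltW e_gt0) (ltW xz_size).
  by move: yz_uniform xz_size; lra.
- by lra.
- by move: b_prec_gt; lra.
Qed.

Lemma low_plane_between : exists p,
  [/\ admissible (6 * eta) p, lsize p < lsize z & lprec y + e / 16 * lsize x <= lprec p].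
Proof.
have [K_ge1 K_small eta_small e2_small e_small] := error_scale.
have [p [p_pos p_size p_prec]] := exists_inner_bracket.
have [[_ y_prec] [_ z_prec] [_ a_prec] [_ b_prec]] := And4 y_adm z_adm a_adm b_adm.
have /andP[eta_a eta_b] := eta_lsize_inner_le.
have eta_y := ler_wpM2l (ltW eta_gt0) (ltW yx_size).
have eta_z := ler_wpM2l (ltW eta_gt0) lsize_right_le.
have y_half : lsize x / 2 - 2 * K <= lsize y by have := lsize_left_ge; lra.
have p_below_z : lsize p <= lsize z - e * (e * lsize x) / 4.
  by have := lsize_inner_le; have := e_lsize_inner_ge; move: a_prec_le; lra.
exists p; split; last 1 first.
- case: p_prec => p_prec; first by have := flank_size_gap; lra.
  have := ler_wpM2l (ltW e_gt0) y_half; have := ler_wpM2r (le_trans ler01 K_ge1) e_le.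
  by have := inner_gap; lra.
- split=> //; case: p_prec => p_prec.
    have : 0 <= eta * lsize p by rewrite mulr_ge0 ?lsize_ge0 ?(ltW eta_gt0).
    by lra.
  have [_ prec_le _ _] := K_slack; have [a_adm4 _] := inner_admissible.
  have [_ _ eta_quarter] := exponents_small.
  have eta_size : (1 - 6 * eta) * lsize p <=
      (1 - 6 * eta) * (lsize y + lsize b - lprec a + K) by rewrite ler_wpM2l //; lra.
  have := ler_wpM2l (ltW eta_gt0) (prec_le a a_adm4).
  have := ler_wpM2l (ltW eta_gt0) lsize_inner_le_left.
  have := ler_wpM2l (ltW eta_gt0) y_half; have : eta * K <= K by rewrite ler_piMl //; lra.
  by lra.
- by lra.
Qed.

End LowPlane.

Lemma flank_between :
  (forall t, K <= t -> exists a b, consecutive (1 / 2 + e) eta eta t a b) ->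
  exists p,
  [/\ admissible (6 * eta) p, lsize p < lsize z & lprec y + e / 16 * lsize x <= lprec p].
Proof.
move=> exists_consecutive; have [h [h_gt0 hy hz h_low]] := exists_low_plane.
have [|a [b [[a_adm b_adm ab_size ab_uniform] [a_prec b_prec _]]]] :=
    exists_consecutive spread.
  by have := spread_large; have [K_ge1 _ _ _ _] := error_scale; lra.
exact: (low_plane_between h_gt0 hy hz h_low a_adm b_adm ab_size ab_uniform a_prec b_prec).
Qed.

End Flanked.
End Improvement.

Definition isolated (eta : R) (x : point) : Prop :=
  forall p, admissible eta p -> lsize p <= lsize x -> lprec p < lprec x.

Lemma isolated_le (eta eta' : R) (x : point) :
  eta <= eta' -> isolated eta' x -> isolated eta x.
Proof. by move=> eta_le x_iso p /(admissible_le eta_le); exact: x_iso. Qed.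

Lemma exists_flank (eta : R) : 0 < eta < 1 -> exists t0 : R, forall x y0,
  positive x -> t0 <= lprec x -> isolated (6 * eta) x ->
  admissible eta y0 -> lprec y0 <= lprec x -> exists y z,
  [/\ admissible eta y, lsize y < lsize x, lprec y <= lprec x & lprec y0 <= lprec y] /\
  [/\ admissible (6 * eta) z, lsize x < lsize z, lprec x < lprec z,
      (1 / 2 + e) * lsize z - 1 <= lprec y
    & forall p, admissible (6 * eta) p -> lsize p < lsize z -> lprec p <= lprec x].
Proof.
move=> eta01; have [eta_gt0 _] := andP eta01; have eta_le6 : eta <= 6 * eta by lra.
have [t0 consecutive_ex] := uniform_consecutive xi_uniform half_plus_e_gt0 eta01 eta_le6.
exists t0 => x y0 x_pos x_t0 x_iso y0_adm y0_prec.
have [y1 [z [[y1_adm z_adm _ y1z_uniform] [y1_prec xz_prec z_first]]]] :=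
  consecutive_ex _ x_t0.
have xz_size : lsize x < lsize z.
  by rewrite ltNge; apply/negP => /(x_iso z z_adm); rewrite ltNge (ltW xz_prec).
have [y [y_adm y_prec y0y y1y]] : exists y,
    [/\ admissible eta y, lprec y <= lprec x, lprec y0 <= lprec y & lprec y1 <= lprec y].
  have [y01|y10] := lerP (lprec y0) (lprec y1); first by exists y1.
  by exists y0; split => //; exact: ltW.
exists y, z; split; split => //; last exact: le_trans y1y.
rewrite ltNge; apply/negP => xy_size.
have x_adm : admissible eta x.
  split => //; apply: le_trans (le_trans y_adm.2 y_prec).
  by rewrite ler_wpM2l //; case/andP: eta01; lra.
by have := x_iso x (admissible_le eta_le6 x_adm) (lexx _); rewrite ltxx.
Qed.

Lemma isolated_improvement (eps eta : R) :
  eps <= e * e / 8 -> 0 < eta -> eta <= e * e / 200 ->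
  exists S : R, forall x y0, admissible eps x -> S <= lsize x -> isolated (6 * eta) x ->
    admissible eta y0 -> lprec y0 <= lprec x ->
    exists p, [/\ admissible (6 * eta) p, lprec y0 + e / 16 * lsize x <= lprec p
                & lprec p <= lprec x].
Proof.
move=> eps_le eta_gt0 eta_le.
have [ee_le eps_quarter eta_quarter] := exponents_small eps_le eta_le.
have eta01 : 0 < eta < 1 by rewrite eta_gt0; lra.
have [t1 flank] := exists_flank eta01.
have [t2 consecutive_ex] := uniform_consecutive xi_uniform half_plus_e_gt0 eta01 (lexx eta).
have [K K_slack] := exists_uniform_slack (Num.max t1 t2); rewrite ge_max => /andP[t1_K t2_K].
have ee_gt0 : 0 < e * e by rewrite mulr_gt0.
exists (500 * K / (e * e * eta)) => x y0 x_adm.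
rewrite ler_pdivrMr ?mulr_gt0 // [leRHS]mulrC -[leRHS]mulrA => x_large x_iso y0_adm y0_prec.
have x_prec : t1 <= lprec x.
  have := x_adm.2; have [[K_ge1 _] _ _ _] := K_slack; have x_ge0 := lsize_ge0 x_adm.1.
  have eta_x : e * e * (eta * lsize x) <= lsize x.
    by rewrite mulrA ler_piMl // mulr_ile1 ?(ltW ee_gt0) //; lra.
  by have := ler_wpM2r x_ge0 eps_quarter; lra.
have [y [z [[y_adm yx_size yx_prec y0y] [z_adm xz_size xz_prec yz_uniform z_first]]]] :=
  flank x y0 x_adm.1 x_prec x_iso y0_adm y0_prec.
have [t /(le_trans t2_K) /consecutive_ex //|p [p_adm pz_size p_prec]] :=
  flank_between K_slack eps_le eta_gt0 eta_le x_adm y_adm z_adm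
    yx_size xz_size yx_prec xz_prec yz_uniform x_large.
exists p; split => //; last exact: z_first.
by apply: le_trans p_prec; rewrite lerD2r.
Qed.

Lemma iterated_improvement (eps eta : R) (j : nat) :
  eps <= e * e / 8 -> 0 < eta -> 6 ^+ j * eta <= e * e / 200 ->
  exists S : R, forall x, admissible eps x -> S <= lsize x -> isolated (6 ^+ j * eta) x ->
    exists y, [/\ admissible (6 ^+ j * eta) y, j%:R * (e / 16) * lsize x <= lprec y
                & lprec y <= lprec x].
Proof.
move=> eps_le eta_gt0; elim: j => [|j IHj].
  rewrite expr0 mul1r => eta_le.
  have [ee_le eps_quarter eta_quarter] := exponents_small eps_le eta_le.
    have eta01 : 0 < eta < 1 by rewrite eta_gt0; lra.
  have [y y_adm y_prec] := uniform_lprec_gt 0 xi_uniform half_plus_e_gt0 eta01.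
  exists (2 * lprec y) => x [x_pos x_prec] x_large _; exists y; split => //.
    by rewrite !mul0r ltW.
  by have := ler_wpM2r (lsize_ge0 x_pos) eps_quarter; lra.
rewrite exprS -mulrA => eta_le.
have etaj_gt0 : 0 < 6 ^+ j * eta by rewrite mulr_gt0 ?exprn_gt0.
have etaj_le : 6 ^+ j * eta <= e * e / 200 by lra.
have [S1 approach] := IHj etaj_le.
have [S2 improve] := isolated_improvement eps_le etaj_gt0 etaj_le.
exists (Num.max S1 S2) => x x_adm; rewrite ge_max => /andP[x_S1 x_S2] x_iso.
have etaj_le6 : 6 ^+ j * eta <= 6 * (6 ^+ j * eta) by lra.
have [y [y_adm y_ge y_le]] := approach x x_adm x_S1 (isolated_le etaj_le6 x_iso).
have [p [p_adm p_ge p_le]] := improve x y x_adm x_S2 x_iso y_adm y_le.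
by exists p; split => //; rewrite -natr1; lra.
Qed.

Lemma better_approximation (eps eps' : R) : eps <= e * e / 8 -> 0 < eps' ->
  exists S : R, forall x, admissible eps x -> S <= lsize x ->
    exists p, [/\ admissible eps' p, lsize p <= lsize x & lprec x <= lprec p].
Proof.
move=> eps_le eps'_gt0; pose M := (Num.truncn (32 / e)).+1.
have M_large : 2 <= M%:R * (e / 16).
  by have := truncnS_gt (32 / e); rewrite -/M ltr_pdivrMr //; lra.
have pow_gt0 : 0 < 6 ^+ M :> R by rewrite exprn_gt0.
pose etaM := Num.min eps' (e * e / 200).
have etaM_gt0 : 0 < etaM by rewrite lt_min eps'_gt0 divr_gt0 ?mulr_gt0.
have etaM_le : 6 ^+ M * (etaM / 6 ^+ M) <= e * e / 200.
  by rewrite mulrC divfK ?gt_eqF // ge_min lexx orbT.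
have eta_gt0 : 0 < etaM / 6 ^+ M by rewrite divr_gt0.
have [S approach] := iterated_improvement eps_le eta_gt0 etaM_le.
have [K [[K_ge1 _] prec_le _ _] _] := exists_uniform_slack 0.
exists (Num.max S (K + 1)) => x x_adm; rewrite ge_max => /andP[x_S x_K].
apply: contrapT => no_better.
have x_iso : isolated (6 ^+ M * (etaM / 6 ^+ M)) x.
  move=> p p_adm p_size; rewrite ltNge; apply/negP => p_prec; apply: no_better.
  exists p; split => //; apply: admissible_le p_adm.
  by rewrite mulrC divfK ?gt_eqF // ge_min lexx.
have [y [_ y_ge y_le]] := approach x x_adm x_S x_iso.
have [_ eps_quarter _] := exponents_small eps_le etaM_le.
have := prec_le x (admissible_le eps_quarter x_adm).
by have := ler_wpM2r (lsize_ge0 x_adm.1) M_large; lra.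
Qed.

End UniformApproximation.

(** * The exponents beta *)

Lemma dev_le_powR (p : point) (B c : R) : positive p -> 0 < B ->
  (dev p <= B `^ (- c)) = (c * ln B <= lprec p).
Proof.
by move=> p_pos B_gt0; rewrite /powR gt_eqF // dev_expR // ler_expR mulNr lerN2.
Qed.

Lemma beta_setP (eps b : R) : beta_set eps xi b <-> 0 < b /\
  exists T0 : R, forall T, T0 <= T ->
  exists p, [/\ admissible eps p, lsize p <= T & T / b <= lprec p].
Proof.
have approxE p B : positive p -> 0 < B ->
    (dev p <= Num.min (B `^ (- (1 / b))) (lead p `^ (eps - 1))) =
    (ln B / b <= lprec p) && ((1 - eps) * lsize p <= lprec p).
  move=> p_pos B_gt0; rewrite le_min -(opprB 1 eps) !dev_le_powR ?lead_gt0 //.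
  by rewrite mul1r mulrC.
split=> [] [b_gt0]; last first.
  move=> [T0 approx]; split => //; exists (expR T0); split; first exact: num_real.
  move=> B B_gt; have B_gt0 : 0 < B := lt_trans (expR_gt0 _) B_gt.
  have [|p [[p_pos p_adm] p_size p_prec]] := approx (ln B).
    by rewrite -(expRK T0) ler_ln ?posrE ?expR_gt0 // ltW.
  exists (coord0 p), (coord1 p), (coord2 p); rewrite gtr0_norm // -/(lead p).
  rewrite lead_expR // -{1}(lnK (B_gt0 : _ \in Num.pos)) ler_expR -lead_expR //.
  by rewrite -/(dev p) approxE // p_adm p_prec.
move=> [M [_ near_M]]; split => //; exists M => T M_le.
have [|q0 [q1 [q2 [q_ge1 q_le q_dev]]]] := near_M (expR T).
  by have := expR_ge1Dx T; lra.
have [|p [p_pos p0E p_dev]] := @exists_positive (Point q0 q1 q2).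
  by rewrite -normr_gt0.
move: q_le q_dev; rewrite -[Lxi _ _ _ _]/(dev (Point q0 q1 q2)) -p_dev.
rewrite -[`|q0|]/(`|coord0 (Point q0 q1 q2)|) -p0E -/(lead p) approxE ?expR_gt0 // expRK.
rewrite lead_expR // ler_expR => p_size /andP[p_prec p_adm].
by exists p.
Qed.

Lemma beta_eps_le_beta0 (eps : R) : 0 < eps < 1 -> (beta_eps eps xi <= beta0 xi)%E.
Proof. by move=> eps01; apply: ereal_sup_ubound; exists eps. Qed.

Lemma beta0_lt_uniform (b : R) : 1 < b -> (beta0 xi < b%:E)%E -> uniform b^-1.
Proof.
move=> b_gt1 beta0_lt eta eta01.
have [_ [c c_set <-]] := ereal_inf_lt (le_lt_trans (beta_eps_le_beta0 eta01) beta0_lt).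
rewrite lte_fin => c_lt; have [c_gt0 [T0 approx]] := (beta_setP eta c).1 c_set.
exists (Num.max (T0 + 1) 1) => T; rewrite ge_max => /andP[T_T0 T_ge1].
have [|p [p_adm p_size p_prec]] := approx (T - 1); first by lra.
exists p; split => //; first by lra.
apply: le_trans p_prec; have b_gt0 := lt_trans ltr01 b_gt1.
have inv_le1 : b^-1 <= 1 by rewrite invf_le1 // ltW.
have inv_le : b^-1 <= c^-1 by rewrite lef_pV2 ?posrE // ltW.
by have := ler_wpM2l (_ : 0 <= T - 1) inv_le; rewrite subr_ge0 => /(_ T_ge1); lra.
Qed.

Lemma beta_set_subset (e eps eps' : R) : non_quadratic xi ->
  0 < e -> e <= 1 / 6 -> uniform (1 / 2 + e) -> eps <= e * e / 8 -> 0 < eps' ->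
  (beta_set eps xi `<=` beta_set eps' xi)%classic.
Proof.
move=> xi_nq e_gt0 e_le xi_uniform eps_le eps'_gt0 b /beta_setP [b_gt0 [T0 approx]].
have [S better] := better_approximation xi_nq e_gt0 e_le xi_uniform eps_le eps'_gt0.
have [M small_bounded] := lprec_bounded S.
apply/beta_setP; split => //; exists (Num.max T0 (b * (M + 1))) => T.
rewrite ge_max => /andP[T_T0]; rewrite mulrC -ler_pdivlMr // => T_M.
have [x [x_adm x_size x_prec]] := approx T T_T0.
have x_large : S <= lsize x.
  by rewrite leNgt; apply/negP => /ltW /(small_bounded x x_adm.1); lra.
have [p [p_adm p_size p_prec]] := better x x_adm x_large.
by exists p; split => //; [exact: le_trans x_size | exact: le_trans p_prec].
Qed.

Lemma beta_eps_eq_beta0 (e eps : R) : non_quadratic xi ->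
  0 < e -> e <= 1 / 6 -> uniform (1 / 2 + e) -> 0 < eps -> eps <= e * e / 8 ->
  beta_eps eps xi = beta0 xi.
Proof.
move=> xi_nq e_gt0 e_le xi_uniform eps_gt0 eps_le; apply/eqP; rewrite eq_le.
apply/andP; split.
  apply: beta_eps_le_beta0; rewrite eps_gt0 (le_lt_trans eps_le) //.
  have : e * e <= 1 by rewrite mulr_ile1 ?ltW //; lra.
  by lra.
apply: ge_ereal_sup => _ [eps' /= /andP[eps'_gt0 _] <-].
apply: ereal_inf_le_tmp; apply: image_subset.
exact: beta_set_subset xi_nq e_gt0 e_le xi_uniform eps_le eps'_gt0.
Qed.

End Approximation.

Definition intermediate_exponent (R : realType) (v : \bar R) : R :=
  Num.max ((fine v + 2) / 2) (3 / 2).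

Lemma intermediate_exponentP (R : realType) (v : \bar R) : (v < 2%:E)%E ->
  [/\ 3 / 2 <= intermediate_exponent v, intermediate_exponent v < 2
    & (v < (intermediate_exponent v)%:E)%E].
Proof.
rewrite /intermediate_exponent le_max lexx orbT gt_max.
case: v => [r||] //=; rewrite ?lte_fin ?ltNyr ?lt_max => v_lt;
  split=> //; first [apply/andP; split | apply/orP; left]; lra.
Qed.

Definition uniform_excess (R : realType) (v : \bar R) : R :=
  (intermediate_exponent v)^-1 - 1 / 2.

Lemma uniform_excess_bounds (R : realType) (v : \bar R) : (v < 2%:E)%E ->
  0 < uniform_excess v <= 1 / 6.
Proof.
move=> /intermediate_exponentP[b_ge b_lt _].
have b_gt0 : 0 < intermediate_exponent v by lra.
rewrite /uniform_excess subr_gt0 mul1r ltf_pV2 ?posrE // b_lt /=.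
have : (intermediate_exponent v)^-1 <= (3 / 2)^-1 by rewrite lef_pV2 ?posrE //; lra.
by lra.
Qed.

Theorem theorem1p3 (R : realType) :
  exists eps1 : \bar R -> R,
    forall xi : R,
      irrational xi -> non_quadratic xi -> (beta0 xi < 2%:E)%E ->
      0 < eps1 (beta0 xi) /\
      forall eps : R, 0 < eps < eps1 (beta0 xi) -> beta_eps eps xi = beta0 xi.
Proof.
exists (fun v => uniform_excess v * uniform_excess v / 8) => xi xi_irr xi_nq beta0_lt2.
have /andP[e_gt0 e_le] := uniform_excess_bounds beta0_lt2.
have [b_ge _ beta0_lt] := intermediate_exponentP beta0_lt2.
split=> [|eps /andP[eps_gt0 eps_lt]]; first by rewrite divr_gt0 ?mulr_gt0.
have xi_uniform : uniform xi (1 / 2 + uniform_excess (beta0 xi)).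
  by rewrite addrC subrK; apply: beta0_lt_uniform => //; lra.
apply: (beta_eps_eq_beta0 xi_irr xi_nq e_gt0 e_le xi_uniform eps_gt0).
exact: ltW.
Qed.
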